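(* Let $n\ge 1$, let $B_0$ be the initial exchange matrix (at an arbitrary vertex $t_0\in\mathbb{T}_n$) of a cluster pattern of type $A_n$, and for $1\le i\le n$ and $t\in\mathbb{T}_n$ let $F_{i;t}^{B_0;t_0}(y_1,\dots,y_n)$ be the corresponding $F$-polynomial. Then every $F_{i;t}^{B_0;t_0}(y_1,\dots,y_n)$ is log-concave (as a polynomial in $y_1,\dots,y_n$).
   Context: **Log-concavity.** A nonzero Laurent polynomial with non-negative real coefficients $f(y_1,\dots,y_m)=\sum_{i_1=l_1}^{n_1}\cdots\sum_{i_m=l_m}^{n_m}a_{i_1,\dots,i_m}y_1^{i_1}\cdots y_m^{i_m}$ is called log-concave if for every $1\le j\le m$ and all indices with $l_j\le i_j\le n_j$ one has $$a_{i_1,\dots,i_j,\dots,i_m}^2\ \ge\ a_{i_1,\dots,i_j-1,\dots,i_m}\,a_{i_1,\dots,i_j+1,\dots,i_m},$$ where coefficients with $j$-th index equal to $l_j-1$ or $n_j+1$ are set to $0$. **Cluster patterns with principal coefficients.** Write $[a]_+=\max(a,0)$. Let $\mathbb{P}=\mathrm{Trop}(y_1,\dots,y_n)$ be the tropical semifield: the free multiplicative abelian group on $y_1,\dots,y_n$ with addition $\prod_i y_i^{a_i}\oplus\prod_i y_i^{b_i}=\prod_i y_i^{\min(a_i,b_i)}$. Let $\mathbb{Q}\mathbb{P}$ be the fraction field of the group ring $\mathbb{Z}\mathbb{P}$, and let $\mathcal{F}$ be a field of rational functions in $n$ variables over $\mathbb{Q}\mathbb{P}$. A labeled seed is a triple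 $(\mathbf{x},\mathbf{y},B)$ with $\mathbf{x}$ an $n$-tuple of algebraically independent generators of $\mathcal{F}$ over $\mathbb{Q}\mathbb{P}$, $\mathbf{y}$ an $n$-tuple of elements of $\mathbb{P}$, and $B=(b_{ij})\in\mathrm{Mat}_{n\times n}(\mathbb{Z})$ skew-symmetrizable. The mutation $\mu_k(\mathbf{x},\mathbf{y},B)=(\mathbf{x}',\mathbf{y}',B')$ is given by: - $x_i'=x_i$ for $i\neq k$, and $x_k'=x_k^{-1}\Big(\frac{y_k}{1\oplus y_k}\prod_j x_j^{[b_{jk}]_+}+\frac{1}{1\oplus y_k}\prod_j x_j^{[-b_{jk}]_+}\Big)$; - $y_k'=y_k^{-1}$, and $y_i'=y_iy_k^{[b_{ki}]_+}(1\oplus y_k)^{-b_{ki}}$ for $i\ne k$; - $b_{ij}'=-b_{ij}$ if $i=k$ or $j=k$, and $b_{ij}'=b_{ij}+[b_{ik}]_+b_{kj}+b_{ik}[-b_{kj}]_+$ otherwise. (Here $x_i,y_i$ in the mutation formulas denote the entries of the seed being mutated.) Let $\mathbb{T}_n$ be the $n$-regular tree whose edges are labeled by $1,\dots,n$ so that the $n$ edges at each vertex have distinct labels. A cluster pattern assigns to each $t\in\mathbb{T}_n$ a seed $(\mathbf{x}_t,\mathbf{y}_t,B_t)$, $\mathbf{x}_t=(x_{1;t},\dots,x_{n;t})$, such that seeds joined by an edge labeled $k$ are related by $\mu_k$. It has principal coefficients at $t_0$ if $\mathbf{y}_{t_0}=(y_1,\dots,y_n)$ is the tuple of generators of $\mathbb{P}$.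 The initial seed is the one at $t_0$, with $\mathbf{x}_{t_0}=(x_1,\dots,x_n)$ and $B_{t_0}=B_0$. By known results, each $x_{i;t}$ is a Laurent polynomial in $x_1,\dots,x_n$ with coefficients that are non-negative integer combinations of elements of $\mathbb{P}$. **$F$-polynomials.** For the cluster pattern with principal coefficients at $t_0$ and initial exchange matrix $B_0$, the $F$-polynomial is $F_{i;t}^{B_0;t_0}(y_1,\dots,y_n)=x_{i;t}|_{x_1=\cdots=x_n=1}$, obtained from the expression of $x_{i;t}$ in the initial cluster. It is known to be a polynomial in $y_1,\dots,y_n$. **Type $A_n$.** The Cartan counterpart of $B$ is the matrix $A(B)=(a_{ij})$ with $a_{ii}=2$ and $a_{ij}=-|b_{ij}|$ for $i\neq j$. The pattern is of type $A_n$ if some exchange matrix $B_t$ in it has Cartan counterpart equal (up to simultaneous permutation of rows and columns) to the Cartan matrix of type $A_n$; $B_0$ need not itself be the one with this property. *)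

(* Defs.v *)
From HB Require Import structures.
From mathcomp Require Import all_boot all_order all_fingroup all_algebra.
From mathcomp Require Import mpoly.
From Stdlib Require Import ClassicalEpsilon.

Set Implicit Arguments.
Unset Strict Implicit.
Unset Printing Implicit Defensive.

Import Order.TTheory GRing.Theory Num.Theory.
Local Open Scope ring_scope.

(* The box of exponents does not matter: outside it all coefficients vanish.
   For m j = 0 the lower neighbour has exponent -1, hence coefficient 0, and
   the inequality is trivial; so only 0 < m j is required. *)
Definition log_concave (R : numDomainType) (n : nat) (f : {mpoly R[n]}) : Prop :=
  [/\ f != 0,
      forall m : 'X_{1..n}, 0 <= f@_m
    & forall (j : 'I_n) (m : 'X_{1..n}), (0 < m j)%N ->
        f@_(m - U_(j))%MM * f@_(m + U_(j))%MM <= f@_m ^+ 2].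

Definition pos_part (a : int) : int := Num.max a 0.

(* Trop(y_1, .., y_n), written additively: the row vector a stands for the
   Laurent monomial \prod_i y_i ^ (a 0 i).  So the group law of Trop is +, its
   unit is 0, the k-th power of a is a *~ k, and the generator y_i is
   delta_mx 0 i. *)
Definition trop (n : nat) : Type := 'rV[int]_n.

Definition trop_oplus n (a b : 'rV[int]_n) : 'rV[int]_n :=
  \row_i Num.min (a 0 i) (b 0 i).

Definition trop_gen n (i : 'I_n) : 'rV[int]_n := delta_mx 0 i.

(* The Laurent polynomial ring ZP and the polynomial ring Z[y_1, .., y_n] have
   the same field of fractions. *)
Notation QP n := {fraction {mpoly int[n]}}.

(* Rational functions in n variables over QP. *)
Notation ambient n := {fraction {mpoly (QP n)[n]}}.

Definition trop_QP n (a : 'rV[int]_n) : QP n :=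
  \prod_(i < n) (tofrac ('X_i : {mpoly int[n]})) ^ (a 0 i).

Definition QP_ambient n (c : QP n) : ambient n :=
  tofrac (c%:MP : {mpoly (QP n)[n]}).

Definition trop_ambient n (a : 'rV[int]_n) : ambient n :=
  QP_ambient (trop_QP a).

Definition eval_at n (x : 'I_n -> ambient n) (p : {mpoly (QP n)[n]}) :
    ambient n :=
  mmap (@QP_ambient n) x p.

Definition alg_independent n (x : 'I_n -> ambient n) : Prop :=
  forall p : {mpoly (QP n)[n]}, eval_at x p = 0 -> p = 0.

Definition generates_ambient n (x : 'I_n -> ambient n) : Prop :=
  forall z : ambient n, exists p q : {mpoly (QP n)[n]},
    eval_at x q != 0 /\ z = eval_at x p / eval_at x q.

Definition skew_symmetrizable n (B : 'M[int]_n) : Prop :=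
  exists d : 'I_n -> int,
    (forall i, 0 < d i) /\ forall i j, d i * B i j = - (d j * B j i).

Record seed (n : nat) := Seed {
  cluster : {ffun 'I_n -> ambient n};
  coeffs : {ffun 'I_n -> trop n};
  exchange : 'M[int]_n
}.

Definition labeled_seed n (s : seed n) : Prop :=
  [/\ alg_independent (cluster s), generates_ambient (cluster s)
    & skew_symmetrizable (exchange s)].

Section Mutation.

Variables (n : nat) (k : 'I_n) (s : seed n).
Let x := cluster s.
Let y : 'I_n -> 'rV[int]_n := coeffs s.
Let B := exchange s.

(* In P, written additively, 1 (+) y_k is trop_oplus 0 (y k). *)
Definition mutate_cluster : {ffun 'I_n -> ambient n} :=
  [ffun i => if i == k then
     (x k)^-1 *
       (trop_ambient (y k - trop_oplus 0 (y k)) *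
          \prod_(j < n) x j ^ pos_part (B j k) +
        trop_ambient (- trop_oplus 0 (y k)) *
          \prod_(j < n) x j ^ pos_part (- B j k))
   else x i].

Definition mutate_coeffs : {ffun 'I_n -> trop n} :=
  [ffun i => (if i == k then - y k
   else y i + y k *~ pos_part (B k i)
            + trop_oplus 0 (y k) *~ (- B k i)) : trop n].

Definition mutate_exchange : 'M[int]_n :=
  \matrix_(i, j) if (i == k) || (j == k) then - B i j
   else B i j + pos_part (B i k) * B k j + B i k * pos_part (- B k j).

Definition mutate : seed n :=
  Seed mutate_cluster mutate_coeffs mutate_exchange.

End Mutation.

(* The n-regular tree T_n as the Cayley graph of the n-fold free product of
   Z/2: vertices are the words in the labels without two equal consecutive
   letters, and an edge labeled k appends or deletes a last letter k. *)
Definition reduced_word n (w : seq 'I_n) : bool :=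
  sorted (fun i j : 'I_n => i != j) w.

Definition tree (n : nat) : Type := {w : seq 'I_n | reduced_word w}.

Definition tree_edge n (k : 'I_n) (t u : tree n) : bool :=
  (sval u == rcons (sval t) k) || (sval t == rcons (sval u) k).

Record cluster_pattern (n : nat) := ClusterPattern {
  seed_at :> tree n -> seed n;
  seed_at_labeled : forall t, labeled_seed (seed_at t);
  seed_at_edge : forall (k : 'I_n) (t u : tree n),
    tree_edge k t u -> seed_at u = mutate k (seed_at t)
}.

Definition principal_at n (S : cluster_pattern n) (t0 : tree n) : Prop :=
  forall i : 'I_n, coeffs (S t0) i = trop_gen i.

Definition cartan_counterpart n (B : 'M[int]_n) : 'M[int]_n :=
  \matrix_(i, j) if i == j then 2 else - `|B i j|.

Definition cartan_A (n : nat) : 'M[int]_n :=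
  \matrix_(i, j) if i == j then 2
                 else if (i.+1 == j :> nat) || (j.+1 == i :> nat) then -1
                 else 0.

Definition type_A n (S : cluster_pattern n) : Prop :=
  exists (t : tree n) (s : 'S_n),
    row_perm s (col_perm s (cartan_counterpart (exchange (S t)))) = cartan_A n.

(* c is the value at x_1 = .. = x_n = 1 of z, seen as a rational function of
   the cluster x. *)
Definition specializes_at1 n (x : 'I_n -> ambient n) (z : ambient n)
    (c : QP n) : Prop :=
  exists p q : {mpoly (QP n)[n]},
    [/\ q.@[fun=> 1] != 0, z = eval_at x p / eval_at x q
      & c = p.@[fun=> 1] / q.@[fun=> 1]].

Definition is_F_polynomial n (S : cluster_pattern n) (t0 : tree n)
    (i : 'I_n) (t : tree n) (f : {mpoly int[n]}) : Prop :=
  specializes_at1 (cluster (S t0)) (cluster (S t) i) (tofrac f).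

(* Meaningful when S has principal coefficients at t0: the polynomial is then
   known to exist, and it is unique by is_F_polynomial_inj below. *)
Definition F_polynomial n (S : cluster_pattern n) (t0 : tree n)
    (i : 'I_n) (t : tree n) : {mpoly int[n]} :=
  epsilon (inhabits 0) (is_F_polynomial S t0 i t).

Lemma QP_ambient_is_zmod_morphism n : zmod_morphism (@QP_ambient n).
Proof. by move=> a b; rewrite /QP_ambient mpolyCB rmorphB. Qed.

Lemma QP_ambient_is_monoid_morphism n : monoid_morphism (@QP_ambient n).
Proof.
by split=> [|a b]; rewrite /QP_ambient ?mpolyC1 ?rmorph1 // mpolyCM rmorphM.
Qed.

HB.instance Definition _ n :=
  GRing.isZmodMorphism.Build (QP n) (ambient n) (@QP_ambient n)
    (@QP_ambient_is_zmod_morphism n).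
HB.instance Definition _ n :=
  GRing.isMonoidMorphism.Build (QP n) (ambient n) (@QP_ambient n)
    (@QP_ambient_is_monoid_morphism n).

Lemma specializes_at1_inj n (x : 'I_n -> ambient n) z c d :
  alg_independent x ->
  specializes_at1 x z c -> specializes_at1 x z d -> c = d.
Proof.
move=> xfree [p [q [q1 zE ->]]] [p' [q' [q1' zE' ->]]].
have nz r : r.@[fun=> 1] != 0 -> eval_at x r != 0.
  by apply: contra_neq => /xfree ->; rewrite meval0.
have /eqP : eval_at x p / eval_at x q = eval_at x p' / eval_at x q'.
  by rewrite -zE.
rewrite eqr_div ?nz // -subr_eq0 /eval_at -!rmorphM -rmorphB => /eqP/xfree.
move/(congr1 (meval (fun=> 1))); rewrite mevalB !mevalM meval0.
by move/subr0_eq => e; apply/eqP; rewrite (eqr_div _ _ q1 q1'); apply/eqP.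
Qed.

Lemma is_F_polynomial_inj n (S : cluster_pattern n) t0 i t f g :
  is_F_polynomial S t0 i t f -> is_F_polynomial S t0 i t g -> f = g.
Proof.
have [xfree _ _] := seed_at_labeled S t0.
move=> Ff Fg; apply/eqP; rewrite -tofrac_eq; apply/eqP.
exact: specializes_at1_inj xfree Ff Fg.
Qed.

(* Main.v *)
Require Import Defs.
From mathcomp Require Import all_boot all_order all_fingroup all_algebra.
From mathcomp Require Import mpoly zify ring.
From Stdlib Require Import ClassicalEpsilon.

(** Every seed of a pattern of type A_n is encoded by a triangulation of a
    polygon with vertices 0, .., n+2: the exchange matrix is its signed adjacency
    matrix, the exponent of y_e in y_k is the shear coordinate at the arc k of the
    elementary lamination of the initial arc e, and mutation is a flip.  Solving
    the initial triangulation triangle by triangle gives vectors w_v in the plane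
    over Q(y) whose determinants, rescaled by monomials, form a function L on
    chords that equals 1 on sides and initial arcs and satisfies the Ptolemy
    relations with the coefficients of the exchange relations; hence L is the
    value at x = 1 of the cluster variables.  Resolving a chord against an initial
    arc that it crosses replaces it by two pairs of chords, and the two chords of
    a pair cross disjoint sets of initial arcs.  So L is a nonzero polynomial with
    non-negative coefficients and of degree at most 1 in each y_e.  Two
    exponents differing by 2 in y_e then never both occur, and log-concavity is
    immediate. *)

Set Implicit Arguments.
Unset Strict Implicit.
Unset Printing Implicit Defensive.

Import Order.TTheory GRing.Theory Num.Theory.
Local Open Scope ring_scope.

(** * Cyclic order, chords and triangulations *)

Lemma rank_mono (s : seq nat) :
  {in s &, {mono (fun x => count (fun z => z < x)%N s) : x y / (x <= y)%N}}.
Proof.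
move=> x y xs ys; case: (leqP x y) => xy.
  by apply: sub_count => z /= zx; apply: leq_trans xy.
apply/negbTE; rewrite -ltnNge !(seq.permP (perm_to_rem ys)) /= ltnn xy add0n add1n ltnS.
by apply: sub_count => z /= zy; apply: ltn_trans xy.
Qed.

Lemma rank_size (s : seq nat) x : x \in s -> (count (fun z => z < x) s < size s)%N.
Proof.
move=> xs; rewrite (seq.permP (perm_to_rem xs)) (perm_size (perm_to_rem xs)) /=.
by rewrite ltnn ltnS count_size.
Qed.

(* Replacing six numbers by their ranks preserves their order, so a statement
   that depends only on the order can be checked on ranks below 6. *)
Lemma order_check6 (P : nat -> nat -> nat -> nat -> nat -> nat -> bool) :
  (forall f u v a b c d,
     {in [:: u; v; a; b; c; d] &, {mono f : x y / (x <= y)%N}} ->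
     P (f u) (f v) (f a) (f b) (f c) (f d) = P u v a b c d) ->
  (let I := iota 0 6 in
   all (fun u => all (fun v => all (fun a => all (fun b => all (fun c =>
     all (fun d => P u v a b c d) I) I) I) I) I) I) ->
  forall u v a b c d, P u v a b c d.
Proof.
move=> Pf chk u v a b c d; pose s := [:: u; v; a; b; c; d].
pose r x := count (fun z => z < x)%N s.
have chkP Q : all Q (iota 0 6) -> {in s, forall x, Q (r x)}.
  by move=> /allP QI x xs; apply: QI; rewrite mem_iota rank_size.
rewrite -(Pf r); last exact: rank_mono.
have [[hu hv ha] [hb hc hd]] :
    [/\ u \in s, v \in s & a \in s] /\ [/\ b \in s, c \in s & d \in s].
  by rewrite !inE !eqxx !orbT.
exact: (chkP _ (chkP _ (chkP _ (chkP _ (chkP _ (chkP _ chk _ hu) _ hv) _ ha) _ hb) _ hc) _ hd).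
Qed.

Definition cyc (a b c d : nat) : bool :=
  [|| [&& a < b, b < c & c < d], [&& b < c, c < d & d < a],
      [&& c < d, d < a & a < b] | [&& d < a, a < b & b < c]]%N.

Definition same (p : nat * nat) (a b : nat) : bool :=
  (p.1 == a) && (p.2 == b) || (p.1 == b) && (p.2 == a).

Definition cross (p : nat * nat) (a b : nat) : bool :=
  cyc p.1 a p.2 b || cyc p.1 b p.2 a.

(* The elementary lamination of the chord p joins p.1 - 1/2 to p.2 - 1/2; cut p
   is the indicator of the vertices on one side of it. *)
Definition cut (p : nat * nat) (v : nat) : bool :=
  (p.1 <= v < p.2)%N || (p.2 <= v < p.1)%N.

(** The two ways a curve with side indicator [K] contributes to the shear coordinate at the diagonal
    [a c]: it separates the side [a b] from [c d], or [b c] from [d a]. *)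
Definition shear_pos (K : nat -> bool) a b c d : bool :=
  [&& K a == K b, K c == K d & K a != K c].
Definition shear_neg (K : nat -> bool) a b c d : bool :=
  [&& K a == K d, K b == K c & K a != K b].
Definition shear K a b c d : int :=
  (shear_pos K a b c d)%:Z - (shear_neg K a b c d)%:Z.

(** A simple curve meets the boundary in two points only, so its side indicator cannot alternate
    around four vertices. *)
Definition non_alternating (K : nat -> bool) : Prop :=
  forall a b c d, cyc a b c d -> ~~ [&& K a == K c, K b == K d & K a != K b].

(** The notions involved unfold to comparisons of labels, hence are invariant under a monotone
    relabelling; the cases with labels below 6 are then computed. *)
Ltac order_check :=
  apply: order_check6;
  [ let H := fresh in
    move=> f ? ? ? ? ? ? H;
    rewrite /cross /cut /same /shear_pos /shear_neg /cut /cyc /= ?(ltnNge, eqn_leq);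
    rewrite !H ?inE ?eqxx ?orbT //
  | by vm_compute ].

Lemma cut_non_alternating p : non_alternating (cut p).
Proof. case: p => u v a b c d; rewrite /cut /cyc /=; lia. Qed.

(** A chord avoiding [a c] stays on one side of it. Each event counted on the left forces it to
    cross [b d], and these events exclude each other. This bounds the degree of the first term of a
    Ptolemy relation; [cross_shear_neg] treats the second. *)
Lemma cross_shear_pos p a b c d : cyc a b c d -> ~~ cross p a c ->
  (shear_pos (cut p) a b c d + cross p a b + cross p c d <= cross p b d)%N.
Proof.
case: p => u v h1 h2; apply: (implyP (implyP _ h1) h2) => {h1 h2}.
move: u v a b c d; order_check.
Qed.

Lemma cross_shear_neg p a b c d : cyc a b c d -> ~~ cross p a c ->
  (shear_neg (cut p) a b c d + cross p b c + cross p d a <= cross p b d)%N.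
Proof.
case: p => u v h1 h2; apply: (implyP (implyP _ h1) h2) => {h1 h2}.
move: u v a b c d; order_check.
Qed.

Lemma cyc_rot a b c d : cyc a b c d = cyc b c d a.
Proof.
rewrite /cyc.
by case: (a < b)%N; case: (b < c)%N; case: (c < d)%N; case: (d < a)%N.
Qed.

Lemma cyc_neq a b c d : cyc a b c d ->
  ((a == b) = false) * ((a == c) = false) * ((a == d) = false) *
  ((b == a) = false) * ((b == c) = false) * ((b == d) = false) *
  ((c == a) = false) * ((c == b) = false) * ((c == d) = false) *
  ((d == a) = false) * ((d == b) = false) * ((d == c) = false).
Proof. by rewrite /cyc => h; do !split; lia. Qed.

Lemma same_sym p a b : same p a b = same p b a.
Proof. by rewrite /same orbC. Qed.

Lemma chordP p a b : reflect (p = (a, b) \/ p = (b, a)) (same p a b).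
Proof.
case: p => u v; apply: (iffP orP) => -[] /=.
- by case/andP => /eqP -> /eqP ->; left.
- by case/andP => /eqP -> /eqP ->; right.
- by case=> -> ->; left; rewrite !eqxx.
- by case=> -> ->; right; rewrite !eqxx.
Qed.

Lemma sameE p a b c d : same p a b ->
  same p c d = (a == c) && (b == d) || (a == d) && (b == c).
Proof.
case/chordP => -> //; rewrite /same /= orbC.
by congr orb; rewrite andbC.
Qed.

Lemma cross_sym p a b : cross p a b = cross p b a.
Proof. by rewrite /cross orbC. Qed.

Lemma same_cross p q a b : same q a b -> cross p q.1 q.2 = cross p a b.
Proof. by case/chordP => -> //=; rewrite cross_sym. Qed.

Lemma cross_same p a b c d : same p a c -> cross p b d = cyc a b c d || cyc a d c b.
Proof.
by case/chordP => -> //=; rewrite /cross /= orbC; congr orb; rewrite [LHS]cyc_rot [LHS]cyc_rot.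
Qed.

Lemma cross_comm p q : cross p q.1 q.2 = cross q p.1 p.2.
Proof.
by rewrite /cross orbC; congr orb; [rewrite [RHS]cyc_rot | rewrite [LHS]cyc_rot].
Qed.

(** The polygon has the [N.+1] vertices [0, .., N]; the last two disjuncts close it up. *)
Definition side N a b : bool :=
  [|| b == a.+1, a == b.+1, (a == 0%N) && (b == N) | (b == 0%N) && (a == N)].

Definition edge N n (tau : 'I_n -> nat * nat) a b : bool :=
  side N a b || [exists j, same (tau j) a b].

Lemma edge_sym N n (tau : 'I_n -> nat * nat) a b : edge N tau a b = edge N tau b a.
Proof.
rewrite /edge; congr orb; first by rewrite /side; lia.
by apply: eq_existsb => j; rewrite same_sym.
Qed.

Definition quad_sign p a b c d : int :=
  (same p a b)%:Z + (same p c d)%:Z - (same p b c)%:Z - (same p d a)%:Z.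

(** The four sides of the quadrilateral are distinct chords, so at most one of the four indicators
    is nonzero and nothing cancels. *)
Lemma quad_signP p a b c d : cyc a b c d ->
  [/\ pos_part (quad_sign p a b c d) = (same p a b)%:Z + (same p c d)%:Z,
      pos_part (- quad_sign p a b c d) = (same p b c)%:Z + (same p d a)%:Z
    & quad_sign p a b c d = 0 ->
      [/\ same p a b = false, same p b c = false, same p c d = false & same p d a = false]].
Proof.
move=> H; rewrite /quad_sign /pos_part.
have [E|E1] := boolP (same p a b); first by rewrite !(sameE _ _ E) !(cyc_neq H) ?eqxx.
have [E|E2] := boolP (same p b c); first by rewrite !(sameE _ _ E) !(cyc_neq H) ?eqxx.
have [E|E3] := boolP (same p c d); first by rewrite !(sameE _ _ E) !(cyc_neq H) ?eqxx.
by have [E|E4] := boolP (same p d a).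
Qed.

(* The arc k is the diagonal a c of the quadrilateral a b c d.  K e is the
   indicator of one side of the lamination e, and Y e k the exponent of y_e in
   y_k; with E := void only the exchange matrix B is constrained. *)
Record quad N n (tau : 'I_n -> nat * nat) (B : 'M[int]_n) (E : Type)
    (K : E -> nat -> bool) (Y : E -> 'I_n -> int) k a b c d : Prop := Quad {
  quad_cyc : cyc a b c d;
  quad_le : [/\ a <= N, b <= N, c <= N & d <= N]%N;
  quad_diag : same (tau k) a c;
  quad_edge : [/\ edge N tau a b, edge N tau b c, edge N tau c d & edge N tau d a];
  quad_col : forall j, B j k = quad_sign (tau j) a b c d;
  quad_shear : forall e, Y e k = shear (K e) a b c d
}.

(* Maximality of the arcs is implied: see [noncross_edge]. *)
Record triangulated N n (tau : 'I_n -> nat * nat) (B : 'M[int]_n) (E : Type)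
    (K : E -> nat -> bool) (Y : E -> 'I_n -> int) : Prop := Triangulated {
  tri_inj : forall i j, same (tau i) (tau j).1 (tau j).2 -> i = j;
  tri_noncross : forall i j, ~~ cross (tau i) (tau j).1 (tau j).2;
  tri_quad : forall k, exists a b c d, quad N tau B K Y k a b c d;
  tri_outer : exists m, [/\ (0 < m < N)%N, edge N tau 0 m & edge N tau m N]
}.

(** * Flips *)

(** A half-turn preserves both pairs of opposite sides and hence all signs; a quarter-turn would
    reverse them. *)
Lemma quad_rot N n (tau : 'I_n -> nat * nat) B (E : Type) (K : E -> nat -> bool) Y k a b c d :
  quad N tau B K Y k a b c d -> quad N tau B K Y k c d a b.
Proof.
case=> H1 [H2 H3 H4 H5] H6 [H7 H8 H9 H10] H11 H12; split=> //.
- by rewrite cyc_rot cyc_rot.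
- by rewrite same_sym.
- by move=> j; rewrite H11 /quad_sign; ring.
- move=> e; rewrite H12 /shear /shear_pos /shear_neg.
  by case: (K e a); case: (K e b); case: (K e c); case: (K e d).
Qed.

(** A chord crossing [b d] enters the quadrilateral; if it crosses no side, it can only end at [a]
    and [c]. *)
Lemma cross_quad t a b c d : cyc a b c d ->
  ~~ cross t a b -> ~~ cross t b c -> ~~ cross t c d -> ~~ cross t d a ->
  cross t b d -> same t a c.
Proof.
case: t => u v h1 h2 h3 h4 h5 h6.
apply: (implyP (implyP (implyP (implyP (implyP (implyP _ h1) h2) h3) h4) h5) h6).
move=> {h1 h2 h3 h4 h5 h6}; move: u v a b c d; order_check.
Qed.

Lemma cyc_trans a z b c d : cyc a z b c -> cyc a b c d -> cyc a z b d.
Proof.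
move=> h1 h2; apply: (implyP (implyP _ h1) h2) => {h1 h2}.
move: 0%N a z b c d; order_check.
Qed.

Lemma cyc_swap a b c d x : cyc a b c d -> cyc a c b x = false.
Proof. by rewrite /cyc; lia. Qed.

Lemma cyc_swap' a b c d x : cyc a b c d -> cyc a c x b = false.
Proof. by rewrite /cyc; lia. Qed.

Lemma cyc_trans' a z b c d : cyc a z b d -> cyc a b c d -> cyc a z b c.
Proof.
move=> h1 h2; apply: (implyP (implyP _ h1) h2) => {h1 h2}.
move: 0%N a z b c d; order_check.
Qed.

Section Triangulation.
Variables (N n : nat) (tau : 'I_n -> nat * nat) (B : 'M[int]_n) (E : Type).
Variables (K : E -> nat -> bool) (Y : E -> 'I_n -> int).
Hypothesis HT : triangulated N tau B K Y.

Lemma tri_le j : [/\ (tau j).1 <= N, (tau j).2 <= N & (tau j).1 != (tau j).2]%N.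
Proof.
have [a [b [c [d [H1 [H2 _ H3 _] /chordP H4 _ _ _]]]]] := tri_quad HT j.
by case: H4 => -> /=; rewrite H2 H3 !(cyc_neq H1).
Qed.

Lemma edge_noncross j a b : (a <= N)%N -> (b <= N)%N -> edge N tau a b -> ~~ cross (tau j) a b.
Proof.
move=> Ha Hb; case/orP=> [|/existsP [i Hi]].
  have [] := tri_le j; rewrite /side /cross /cyc; lia.
by rewrite -(same_cross _ Hi) (tri_noncross HT).
Qed.

Lemma same_inj i j a b : same (tau i) a b -> same (tau j) a b -> i = j.
Proof.
move=> H1 H2; apply: (tri_inj HT); move: H1.
by case/chordP: H2 => -> //=; rewrite same_sym.
Qed.

End Triangulation.

Section Flip.
Variables (N n : nat) (tau : 'I_n -> nat * nat) (B : 'M[int]_n) (E : Type).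
Variables (K : E -> nat -> bool) (Y : E -> 'I_n -> int).
Hypothesis HT : triangulated N tau B K Y.
Hypothesis nalt : forall e, non_alternating (K e).
Hypothesis HB0 : forall i j, B i j = 0 -> B j i = 0.
Variables (k : 'I_n) (tau' : 'I_n -> nat * nat) (B' : 'M[int]_n) (Y' : E -> 'I_n -> int).
Hypothesis tau'N : forall i, i != k -> tau' i = tau i.
Hypothesis HB' : forall i j, B' i j = if (i == k) || (j == k) then - B i j
   else B i j + pos_part (B i k) * B k j + B i k * pos_part (- B k j).
Hypothesis HY' : forall e i, Y' e i = if i == k then - Y e k else
   Y e i + Y e k * pos_part (B k i) + Num.min 0 (Y e k) * - B k i.

Section Quad.
Variables (a b c d : nat).
Hypothesis Hq : quad N tau B K Y k a b c d.
Hypothesis tau'k : same (tau' k) b d.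

Lemma edge_flip u v : same (tau k) u v = false -> edge N tau u v -> edge N tau' u v.
Proof.
move=> Hk; case/orP=> [|/existsP [i Hi]]; rewrite /edge; first by move=> ->.
apply/orP; right; apply/existsP; exists i; rewrite tau'N //.
by apply: contraFneq Hk => <-.
Qed.

Lemma new_edge : edge N tau' b d.
Proof. by apply/orP; right; apply/existsP; exists k. Qed.

Lemma not_diag_k i : i != k -> same (tau i) a c = false /\ same (tau i) b d = false.
Proof.
move=> ik; case: Hq => H1 _ H3 _ _ _; split; apply: contra_neqF ik => H.
  exact: (same_inj HT H H3).
have := tri_noncross HT k i.
by rewrite (same_cross _ H) (cross_same _ _ H3) H1.
Qed.

(** The new diagonal has the old quadrilateral turned by a quarter, which negates signs and shear
    coordinates, as mutation does at [k]. *)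
Lemma quad_flip_k : quad N tau' B' K Y' k b c d a.
Proof.
have [H1 [H2 H3 H4 H5] H6 [e1 e2 e3 e4] H11 H12] := Hq; split=> //.
- by rewrite -cyc_rot.
- by split; apply: edge_flip => //; rewrite (sameE _ _ H6) !(cyc_neq H1) ?andbF.
- move=> j; rewrite HB' eqxx orbT H11.
  case: (eqVneq j k) => [->|jk]; last by rewrite tau'N // /quad_sign; ring.
  by rewrite /quad_sign !(sameE _ _ tau'k) !(sameE _ _ H6) !(cyc_neq H1) !andbF.
- move=> e; rewrite HY' eqxx H12 /shear /shear_pos /shear_neg.
  by case: (K e a); case: (K e b); case: (K e c); case: (K e d).
Qed.

(** When [B k i] vanishes, arc [k] is not a side of the quadrilateral of [i], so this quadrilateral
    survives. The chord [b d] is not one of its sides either, because it crosses [a c]. *)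
Lemma quad_flip_far i : i != k -> B k i = 0 -> exists a b c d, quad N tau' B' K Y' i a b c d.
Proof.
move=> ik B0; have [p [q [r [s [H1 [H2 H3 H4 H5] H6 [e1 e2 e3 e4] H11 H12]]]]] := tri_quad HT i.
have [n1 n2 n3 n4] : [/\ same (tau k) p q = false, same (tau k) q r = false,
    same (tau k) r s = false & same (tau k) s p = false].
  by have [_ _] := quad_signP (tau k) H1; rewrite -H11; apply.
have [H1' _ H3' _ _ _] := Hq.
have nc u v : (u <= N)%N -> (v <= N)%N -> edge N tau u v -> same (tau' k) u v = false.
  move=> Hu Hv He; apply: contraNF (edge_noncross HT k Hu Hv He).
  rewrite (sameE _ _ tau'k) (cross_same _ _ H3').
  by case/orP => /andP [/eqP <- /eqP <-]; rewrite H1' ?orbT.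
exists p, q, r, s; split=> //.
- by rewrite tau'N.
- by split; apply: edge_flip.
- move=> j; rewrite HB' (negbTE ik) orbF.
  case: (eqVneq j k) => [->|jk]; last by rewrite tau'N // B0 H11 /pos_part /=; ring.
  by rewrite B0 /quad_sign !nc.
- move=> e; rewrite HY' (negbTE ik) B0 H12 /pos_part /=; ring.
Qed.

(** The quadrilateral of the arc [a b] consists of the triangle [a b c] and a triangle [a z b] on
    the other side; the flip replaces the former by [a b d]. *)
Lemma quad_flip_ab i : same (tau i) a b -> exists z, quad N tau' B' K Y' i a z b d.
Proof.
have [H1 [H2 H3 H4 H5] H6 [e1 e2 e3 e4] H11 H12] := Hq.
move=> Hi; have ik : i != k.
  by apply: contraTneq Hi => ->; rewrite (sameE _ _ H6) !(cyc_neq H1) ?andbF.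
have Bki : B k i != 0.
  apply/eqP => /HB0; rewrite H11 /quad_sign !(sameE _ _ Hi) !eqxx /=.
  by rewrite !(cyc_neq H1) ?andbF.
have [z [x Hz]] : exists z x, quad N tau B K Y i a z b x.
  have [p [q [r [s Hs]]]] := tri_quad HT i.
  have := quad_diag Hs; rewrite (sameE _ _ Hi) => /orP[] /andP [/eqP E1 /eqP E2]; subst.
    by exists q, s.
  by exists s, q; apply: quad_rot.
have cz := quad_cyc Hz.
(* Since [B k i] is nonzero, [a c] is a side of the quadrilateral of [i]; the orientation rules out
   [z = c]. *)
have xc : x = c.
  apply/eqP; move: Bki; apply: contraNT => xc.
  rewrite (quad_col Hz) /quad_sign !(sameE _ _ H6) !(cyc_neq H1) !eqxx /= !andbF.
  rewrite (eq_sym c x) (negbTE xc) ?andbF /= orbF.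
  suff -> : (c == z) = false by [].
  by apply: contraTF cz => /eqP <-; rewrite (cyc_swap _ H1).
subst x.
have [Z1 [Z2 Z3 Z4 Z5] Z6 [f1 f2 f3 f4] Z11 Z12] := Hz.
have B1 : B k i = -1.
  rewrite Z11 /quad_sign !(sameE _ _ H6) !(cyc_neq H1) !(cyc_neq Z1) !eqxx /=.
  by rewrite ?andbF ?orbF.
have Z' := cyc_trans Z1 H1.
exists z; split=> //.
- by rewrite tau'N.
- split=> //; try by apply: edge_flip => //; rewrite (sameE _ _ H6) !(cyc_neq Z1) ?(cyc_neq H1) ?andbF.
  exact: new_edge.
- move=> j; rewrite HB' (negbTE ik) orbF B1.
  case: (eqVneq j k) => [->|jk].
    rewrite B1 /quad_sign !(sameE _ _ tau'k) !(cyc_neq Z') !eqxx /=.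
    by rewrite ?andbF ?orbF.
  have [P1 P2 _] := quad_signP (tau j) H1.
  have [N1 N2] := not_diag_k jk.
  rewrite -H11 in P1 P2; rewrite P1 H11 Z11 tau'N // /quad_sign (same_sym _ c a) N1 N2 /pos_part /=.
  ring.
- move=> e; rewrite HY' (negbTE ik) B1 H12 Z12.
  (* The tropical mutation rule is checked on the 32 values of [K e] at the five vertices; the
     patterns alternating on one of the three quadrilaterals are excluded. *)
  have := @nalt e _ _ _ _ H1; have := @nalt e _ _ _ _ Z1; have := @nalt e _ _ _ _ Z'.
  rewrite /shear /shear_pos /shear_neg /pos_part.
  by case: (K e a); case: (K e b); case: (K e c); case: (K e d); case: (K e z).
Qed.

(** Analogue of [quad_flip_ab] for a side of the opposite sign, which no half-turn relates to
    [a b]. *)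
Lemma quad_flip_bc i : same (tau i) b c -> exists z, quad N tau' B' K Y' i b z c d.
Proof.
have [H1 [H2 H3 H4 H5] H6 [e1 e2 e3 e4] H11 H12] := Hq.
move=> Hi; have ik : i != k.
  by apply: contraTneq Hi => ->; rewrite (sameE _ _ H6) !(cyc_neq H1) ?andbF.
have Bki : B k i != 0.
  apply/eqP => /HB0; rewrite H11 /quad_sign !(sameE _ _ Hi) !eqxx /=.
  by rewrite !(cyc_neq H1) ?andbF.
have [z [x Hz]] : exists z x, quad N tau B K Y i b z c x.
  have [p [q [r [s Hs]]]] := tri_quad HT i.
  have := quad_diag Hs; rewrite (sameE _ _ Hi) => /orP[] /andP [/eqP E1 /eqP E2]; subst.
    by exists q, s.
  by exists s, q; apply: quad_rot.
have cz := quad_cyc Hz.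
have H1' : cyc b c d a by rewrite -cyc_rot.
have xa : x = a.
  apply/eqP; move: Bki; apply: contraNT => xa.
  rewrite (quad_col Hz) /quad_sign !(sameE _ _ H6) !(cyc_neq H1) !eqxx /= !andbF.
  rewrite (eq_sym a x) (negbTE xa) ?andbF /= ?orbF.
  suff -> : (a == z) = false by [].
  by apply: contraTF cz => /eqP <-; rewrite cyc_rot (cyc_swap' _ H1).
subst x.
have [Z1 [Z2 Z3 Z4 Z5] Z6 [f1 f2 f3 f4] Z11 Z12] := Hz.
have B1 : B k i = 1.
  rewrite Z11 /quad_sign !(sameE _ _ H6) !(cyc_neq H1) !(cyc_neq Z1) !eqxx /=.
  by rewrite ?andbF ?orbF.
have Z' : cyc b z c d by exact: cyc_trans' Z1 H1'.
exists z; split=> //.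
- by rewrite tau'N.
- split=> //; try by apply: edge_flip => //; rewrite (sameE _ _ H6) !(cyc_neq Z1) ?(cyc_neq H1) ?andbF.
  by rewrite edge_sym; exact: new_edge.
- move=> j; rewrite HB' (negbTE ik) orbF B1.
  case: (eqVneq j k) => [->|jk].
    rewrite B1 /quad_sign !(sameE _ _ tau'k) !(cyc_neq Z') !eqxx /=.
    by rewrite ?andbF ?orbF.
  have [P1 P2 _] := quad_signP (tau j) H1.
  have [N1 N2] := not_diag_k jk.
  rewrite -H11 in P1 P2; rewrite P1 H11 Z11 tau'N // /quad_sign.
  rewrite (same_sym _ c a) (same_sym _ d b) N1 N2 /pos_part /=.
  ring.
- move=> e; rewrite HY' (negbTE ik) B1 H12 Z12.
  have := @nalt e _ _ _ _ H1; have := @nalt e _ _ _ _ Z1; have := @nalt e _ _ _ _ Z'.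
  rewrite /shear /shear_pos /shear_neg /pos_part.
  by case: (K e a); case: (K e b); case: (K e c); case: (K e d); case: (K e z).
Qed.

Lemma edge_edge_noncross u v p q : (u <= N)%N -> (v <= N)%N -> (p < N)%N -> (q <= N)%N ->
  edge N tau u v -> edge N tau p q -> (p < u < q)%N -> (q < v)%N -> False.
Proof.
move=> hu hv hp hq e1 /orP[|/existsP [j Hj]] l1 l2.
  by move: l1 l2; rewrite /side; lia.
have := edge_noncross HT j hu hv e1; rewrite cross_sym.
by case/chordP: Hj => ->; rewrite /cross /cyc /=; lia.
Qed.

(** Here the flipped arc [0 c] is a side of the outer triangle [0 c N]. Its quadrilateral then has
    [d = N], since otherwise the edges [0 d] and [c N] would cross, and the new outer triangle is
    [0 b N]. *)
Lemma outer_flip_lo : a = 0%N -> edge N tau c N -> (c < N)%N ->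
  exists m, [/\ (0 < m < N)%N, edge N tau' 0 m & edge N tau' m N].
Proof.
have [H1 [H2 H3 H4 H5] H6 [e1 e2 e3 e4] H11 H12] := Hq; move=> a0 eN cN; subst a.
have [l1 l2 l3] : [/\ 0 < b, b < c & c < d]%N by split; move: H1; rewrite /cyc; lia.
have dN : d = N.
  apply/eqP; rewrite eqn_leq H5 leqNgt; apply/negP => dN.
  by apply: (@edge_edge_noncross c N 0%N d) => //; rewrite 1?edge_sym //; lia.
exists b; split; first lia.
- by apply: edge_flip => //; rewrite (sameE _ _ H6) !(cyc_neq H1) ?andbF.
- by move: new_edge; rewrite [in edge _ _ _ d]dN.
Qed.

Lemma outer_flip_hi : c = N -> edge N tau 0 a -> (0 < a)%N ->
  exists m, [/\ (0 < m < N)%N, edge N tau' 0 m & edge N tau' m N].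
Proof.
have [H1 [H2 H3 H4 H5] H6 [e1 e2 e3 e4] H11 H12] := Hq; move=> cN eN a0; subst c.
have [l1 l2 l3] : [/\ d < a, a < b & b < N]%N by split; move: H1; rewrite /cyc; lia.
have d0 : d = 0%N.
  apply/eqP; rewrite -leqn0 leqNgt; apply/negP => d0.
  by apply: (@edge_edge_noncross d N 0%N a) => //; rewrite 1?edge_sym //; lia.
exists b; split; first lia.
- by move: new_edge; rewrite d0 edge_sym.
- by apply: edge_flip => //; rewrite (sameE _ _ H6) !(cyc_neq H1) ?andbF.
Qed.

End Quad.

(** A flip alters only the quadrilaterals of arc [k] itself and of the arcs among [a b], [b c],
    [c d], [d a]; the last two are reduced to the first two by a half-turn. *)
Lemma triangulated_flip a b c d : quad N tau B K Y k a b c d -> same (tau' k) b d ->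
  triangulated N tau' B' K Y'.
Proof.
move=> Hq tau'k; have Hq' := quad_rot Hq; have tau'k' : same (tau' k) d b by rewrite same_sym.
have [H1 [H2 H3 H4 H5] H6 [e1 e2 e3 e4] H11 H12] := Hq.
have new j : j != k -> ~~ cross (tau j) b d.
  move=> jk; have [+ _] := not_diag_k Hq jk.
  by apply: contraFN; apply: cross_quad H1 _ _ _ _; apply: (edge_noncross HT).
have newk j : j != k -> same (tau j) b d = false by move=> jk; case: (not_diag_k Hq jk).
split.
- move=> i j; case: (eqVneq i k) => [->|ik]; case: (eqVneq j k) => [->|jk] //.
  + rewrite (tau'N jk) (sameE _ _ tau'k) => h.
    have := newk _ jk; rewrite /same.
    by case/orP: h => /andP [/eqP <- /eqP <-]; rewrite !eqxx ?orbT.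
  + by rewrite (tau'N ik) => h; have := newk _ ik; case/chordP: tau'k h => -> /=; rewrite 1?same_sym => ->.
  + by rewrite !tau'N //; apply: (tri_inj HT).
- move=> i j; case: (eqVneq i k) => [->|ik]; case: (eqVneq j k) => [->|jk] //.
  + by rewrite /cross /cyc; lia.
  + by rewrite (tau'N jk) cross_comm (same_cross _ tau'k) new.
  + by rewrite (tau'N ik) (same_cross _ tau'k) new.
  + by rewrite !tau'N //; apply: (tri_noncross HT).
- move=> i; case: (eqVneq i k) => [->|ik]; first by exists b, c, d, a; apply: quad_flip_k.
  case: (eqVneq (B k i) 0) => [|/eqP Bki]; first exact: quad_flip_far Hq tau'k _ ik.
  have [|n1] := boolP (same (tau i) a b).
    by case/(quad_flip_ab Hq tau'k) => z; exists a, z, b, d.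
  have [|n2] := boolP (same (tau i) b c).
    by case/(quad_flip_bc Hq tau'k) => z; exists b, z, c, d.
  have [|n3] := boolP (same (tau i) c d).
    by case/(quad_flip_ab Hq' tau'k') => z; exists c, z, d, b.
  have [|n4] := boolP (same (tau i) d a).
    by case/(quad_flip_bc Hq' tau'k') => z; exists d, z, a, b.
  (* An arc that is none of the four sides has [B i k = 0], hence also [B k i = 0]. *)
  case: Bki; apply: HB0; rewrite H11 /quad_sign.
  by rewrite (negbTE n1) (negbTE n2) (negbTE n3) (negbTE n4).
(* The triangle on the side [0 N] persists unless the flipped arc is [0 m] or [m N]. *)
- have [m [mN m1 m2]] := tri_outer HT.
  have /andP [m0 m3] := mN.
  have [E1|E1] := boolP (same (tau k) 0 m).
    move: (H6); rewrite (sameE _ _ E1) => /orP[] /andP [/eqP E2 /eqP E3]; subst.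
      exact: (outer_flip_lo Hq).
    exact: (outer_flip_lo Hq').
  have [E2|E2] := boolP (same (tau k) m N).
    move: (H6); rewrite (sameE _ _ E2) => /orP[] /andP [/eqP E3 /eqP E4].
      by apply: (outer_flip_hi Hq tau'k (esym E4)); rewrite -E3.
    by apply: (outer_flip_hi Hq' tau'k' (esym E4)); rewrite -E3.
  by exists m; split=> //; apply: edge_flip => //; apply: negbTE.
Qed.

End Flip.

(** * Solving a triangulation *)

Section Structure.
Variables (N n : nat) (tau : 'I_n -> nat * nat) (B : 'M[int]_n) (E : Type).
Variables (K : E -> nat -> bool) (Y : E -> 'I_n -> int).
Hypothesis HT : triangulated N tau B K Y.

(** For an arc, its quadrilateral supplies the triangle below it; the only other edge of this length
    is the side [0 N], covered by [tri_outer]. *)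
Lemma third_vertex l r : (l.+1 < r)%N -> (r <= N)%N -> edge N tau l r ->
  exists m, [/\ (l < m < r)%N, edge N tau l m & edge N tau m r].
Proof.
move=> lr rN /orP[sd|/existsP [j Hj]].
  have [l0 r0] : l = 0%N /\ r = N by move: sd; rewrite /side; lia.
  by rewrite l0 r0; apply: (tri_outer HT).
have [a [b [c [d Hq]]]] := tri_quad HT j.
wlog [la rc] : a b c d Hq / l = a /\ r = c.
  move=> W; have := quad_diag Hq; rewrite (sameE _ _ Hj) => /orP[] /andP [/eqP h1 /eqP h2].
    exact: W Hq _.
  by apply: W (quad_rot Hq) _.
have [H1 _ _ [e1 e2 _ _] _ _] := Hq; subst.
by exists b; split=> //; move: H1 lr; rewrite /cyc; lia.
Qed.

(** Descend from the side [0 N] through triangles [l m r] whose span contains [a] and [b]. When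
    [a < m < b], the edges [l m] and [m r] would cross [a b] unless [l = a] and [r = b]. *)
Lemma noncross_edge a b : (a < b <= N)%N ->
  (forall j, ~~ cross (tau j) a b) -> edge N tau a b.
Proof.
case/andP=> ab bN nc.
suff H k l r : (r - l <= k)%N -> (l <= a)%N -> (b <= r <= N)%N -> edge N tau l r -> edge N tau a b.
  by apply: (H N 0%N N); [lia | lia | lia | rewrite /edge /side !eqxx !orbT].
elim: k l r => [|k IH] l r rl la /andP [br rN] e; first lia.
have ncs u v : edge N tau u v -> (u <= N)%N -> (v <= N)%N -> (a < u < b)%N -> ((v < a) || (b < v))%N -> False.
  case/orP=> [|/existsP [j /chordP Hj] hu hv]; first by rewrite /side; lia.
  by have := nc j; case: Hj => ->; rewrite /cross /cyc /=; lia.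
have [lr|lr] := leqP r l.+1.
  have [-> ->] : a = l /\ b = r by lia.
  by [].
have [m [/andP [lm mr] e1 e2]] := third_vertex lr rN e.
have [am|am] := leqP b m.
  by apply: (IH l m) => //; lia.
have [bm|bm] := leqP m a.
  by apply: (IH m r) => //; lia.
have al : l = a.
  apply/eqP; rewrite eqn_leq la leqNgt; apply/negP => h.
  by apply: (ncs m l); rewrite 1?edge_sym //; lia.
have br' : r = b.
  apply/eqP; rewrite eqn_leq br andbT leqNgt; apply/negP => h.
  by apply: (ncs m r) => //; lia.
by rewrite -al -br'.
Qed.

Definition det2 (F : fieldType) (p q : F * F) : F := p.1 * q.2 - p.2 * q.1.

Lemma edge_below_triangle l m r x y : (l < m < r)%N -> (r <= N)%N ->
  edge N tau l m -> edge N tau m r -> edge N tau x y -> (l <= x < y)%N -> (y <= r)%N ->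
  [\/ (y <= m)%N, (m <= x)%N | x = l /\ y = r].
Proof.
move=> lmr rN e1 e2 e /andP [lx xy] yr.
have [|my] := leqP y m; first by constructor 1.
have [|xm] := leqP m x; first by constructor 2.
constructor 3.
have aux u v p q : edge N tau u v -> edge N tau p q -> (u < p < v)%N -> (v < q)%N -> (q <= N)%N -> False.
  move=> euv epq h1 h2 h3; case/orP: euv => [|/existsP [j Hj]]; first by rewrite /side; lia.
  have : ~~ cross (tau j) p q by apply: (edge_noncross HT) => //; lia.
  by case/chordP: Hj => ->; rewrite /cross /cyc /=; lia.
split; apply/eqP; rewrite eqn_leq.
- by rewrite lx andbT leqNgt; apply/negP => h; apply: (aux l m x y) => //; lia.
- by rewrite yr leqNgt; apply/negP => h; apply: (aux x y m r) => //; lia.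
Qed.

(** Below the edge [l r] the triangles form a binary tree, so the vectors can be found one triangle
    at a time, and the two halves share only the vector at [m]. *)
Lemma realize_below (F : fieldType) (v : nat -> nat -> F) :
  (forall x y, v x y != 0) ->
  forall k l r (wl wr : F * F), (r - l <= k)%N -> (l < r <= N)%N -> edge N tau l r ->
  det2 wl wr = v l r ->
  exists w : nat -> F * F, [/\ w l = wl, w r = wr &
    forall x y, (l <= x < y)%N -> (y <= r)%N -> edge N tau x y -> det2 (w x) (w y) = v x y].
Proof.
move=> v0; elim=> [|k IH] l r wl wr rlk /andP [lr rN] e dlr; first lia.
have [lr1|lr1] := leqP r l.+1.
  exists (fun x => if x == l then wl else wr); rewrite eqxx (gtn_eqF lr).
  split=> // x y h1 h2 _.
  have -> : x = l by lia. 
  have -> : y = r by lia.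
  by rewrite eqxx (gtn_eqF lr).
have [m [/andP [lm mr] e1 e2]] := third_vertex lr1 rN e.
(* Cramer's rule: the coordinates of [wm] in the basis [wl], [wr] are dictated by its two
   determinants. *)
pose al := v m r / v l r; pose be := v l m / v l r.
pose wm := (al * wl.1 + be * wr.1, al * wl.2 + be * wr.2).
have d1 : det2 wl wm = v l m.
  have -> : det2 wl wm = be * det2 wl wr by rewrite /det2 /=; ring.
  by rewrite dlr /be divfK.
have d2 : det2 wm wr = v m r.
  have -> : det2 wm wr = al * det2 wl wr by rewrite /det2 /=; ring.
  by rewrite dlr /al divfK.
have [||w1 [w1l w1m h1]] := IH l m wl wm _ _ e1 d1; try lia.
have [||w2 [w2m w2r h2]] := IH m r wm wr _ _ e2 d2; try lia.
exists (fun x => if (x <= m)%N then w1 x else w2 x); rewrite (ltnW lm) leqNgt mr.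
split=> // x y lxy yr exy.
have lmr : (l < m < r)%N by rewrite lm.
case: (edge_below_triangle lmr rN e1 e2 exy lxy yr) => [ym|mx|[-> ->]].
- by rewrite ym (_ : (x <= m)%N); [apply: h1 | lia].
- rewrite [(y <= m)%N]leqNgt (_ : (m < y)%N) /=; last by lia.
  have -> : (if (x <= m)%N then w1 x else w2 x) = w2 x.
    by case: leqP => // xm; rewrite (_ : x = m) ?w1m ?w2m //; lia.
  by apply: h2 => //; lia.
- by rewrite (ltnW lm) leqNgt mr /= w1l w2r.
Qed.

Lemma realize (F : fieldType) (v : nat -> nat -> F) :
  (0 < N)%N -> (forall x y, v x y != 0) ->
  exists w : nat -> F * F,
    forall x y, (x < y <= N)%N -> edge N tau x y -> det2 (w x) (w y) = v x y.
Proof.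
move=> N0 v0.
have [||||w [_ _ H]] := @realize_below F v v0 N 0%N N (1, 0) (0, v 0%N N).
- by rewrite subn0.
- by rewrite N0 leqnn.
- by rewrite /edge /side !eqxx !orbT.
- by rewrite /det2 /=; ring.
by exists w => x y /andP [h1 h2]; apply: H.
Qed.

End Structure.

(** * Orientations of the Dynkin diagram *)

Lemma edge_perm N n (tau : 'I_n -> nat * nat) (s : 'S_n) x y :
  edge N (fun k => tau ((s^-1)%g k)) x y = edge N tau x y.
Proof.
rewrite /edge; congr orb; apply/existsP/existsP => -[j Hj].
  by exists ((s^-1)%g j).
by exists (s j); rewrite permK.
Qed.

Lemma triangulated_perm N n (tau : 'I_n -> nat * nat) (A B : 'M[int]_n) (s : 'S_n)
    (K : void -> nat -> bool) Y Y' :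
  (forall i j, A i j = B (s i) (s j)) ->
  triangulated N tau A K Y -> triangulated N (fun k => tau ((s^-1)%g k)) B K Y'.
Proof.
move=> AB [H1 H2 H3 [m Hm]]; split.
- by move=> i j /H1; apply: perm_inj.
- by move=> i j; apply: H2.
- move=> k; have [a [b [c [d [h1 h2 h3 h4 h5 h6]]]]] := H3 ((s^-1)%g k).
  exists a, b, c, d; split=> //; first by rewrite !edge_perm.
  by move=> j; rewrite -h5 AB !permKV.
- by exists m; rewrite !edge_perm.
Qed.

Lemma quad_sign_pos p a b c d : cyc a b c d -> same p a b || same p c d ->
  quad_sign p a b c d = 1.
Proof.
move=> H /orP[] h; rewrite /quad_sign !(sameE _ _ h) !(cyc_neq H) !eqxx /=;
by rewrite ?andbF.
Qed.

Lemma quad_sign_neg p a b c d : cyc a b c d -> same p b c || same p d a ->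
  quad_sign p a b c d = -1.
Proof.
move=> H /orP[] h; rewrite /quad_sign !(sameE _ _ h) !(cyc_neq H) !eqxx /=;
by rewrite ?andbF.
Qed.

Lemma quad_sign_diag p a b c d : cyc a b c d -> same p a c -> quad_sign p a b c d = 0.
Proof.
move=> H h; rewrite /quad_sign !(sameE _ _ h) !(cyc_neq H) !eqxx /=.
by rewrite ?andbF.
Qed.

Section Snake.
Variables (n : nat) (A : 'M[int]_n.+1).
Hypothesis Askew : forall i j, A i j = - A j i.
Hypothesis Aadj : forall i j : 'I_n.+1, i.+1 = j :> nat -> `|A i j| = 1.
Hypothesis Afar : forall i j : 'I_n.+1, (i.+1 < j)%N -> A i j = 0.

(* The arcs of the snake are nested, each obtained from the previous one by
   moving one endpoint: the left one when left_step holds, else the right one. *)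
Definition left_step (m : nat) : bool :=
  (m < n)%N && (A (inord m.+1) (inord m) == 1).

(** Counts the left moves still to come, so that the last arc starts at vertex [0]; arc [m] spans
    [m.+2] steps. *)
Definition left_end (m : nat) : nat := \sum_(m <= j < n) left_step j.

Definition snake (m : 'I_n.+1) : nat * nat := (left_end m, left_end m + m.+2)%N.

Lemma left_end_step m : left_end m = (left_step m + left_end m.+1)%N.
Proof.
rewrite /left_end; case: (ltnP m n) => mn; first by rewrite big_ltn.
by rewrite !big_geq /left_step ?ltnNge ?mn // ltnW.
Qed.

Lemma left_end_mono m p : (left_end (m + p) <= left_end m <= left_end (m + p) + p)%N.
Proof.
elim: p => [|p IH]; first by rewrite addn0 addn0 leqnn.
have := left_end_step (m + p); rewrite addnS; case: left_step => /=; lia.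
Qed.

Lemma left_end_max : left_end n = 0%N.
Proof. by rewrite /left_end big_geq. Qed.

Lemma left_end_bound m : (m <= n)%N -> (left_end m + m <= n)%N.
Proof.
by move=> mn; have := left_end_mono m (n - m); rewrite subnKC // left_end_max; lia.
Qed.

Lemma snake_up (m j : 'I_n.+1) : m.+1 = j :> nat ->
  A j m = if left_step m then 1 else -1.
Proof.
move=> mj; rewrite /left_step.
have -> : (m < n)%N by have := ltn_ord j; lia.
rewrite inord_val mj inord_val /=; have := Aadj mj; rewrite Askew normrN.
by case: eqVneq => //; lia.
Qed.

Lemma Adiag i : A i i = 0.
Proof. by have := Askew i i; lia. Qed.

Lemma snake_edge (m : 'I_n.+1) x y : left_end m = x -> (left_end m + m.+2)%N = y ->
  edge n.+3 snake x y.
Proof.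
move=> h1 h2; apply/orP; right; apply/existsP; exists m.
by rewrite -h1 -h2 /same /snake /= !eqxx.
Qed.

Lemma nested_noncross u v p q : (p <= u < v)%N -> (v <= q)%N -> ~~ cross (u, v) p q.
Proof. rewrite /cross /cyc /=; lia. Qed.

(** The vertex [v] is the endpoint that the preceding arc does not share with arc [m], and [u] is
    that of the following arc. The following arc is [r u] after a left step and [u l] otherwise,
    which gives it the sign prescribed by [A]. *)
Lemma snake_quad (m : 'I_n.+1) (K : void -> nat -> bool) Y :
  let l := left_end m in let r := (l + m.+2)%N in
  quad n.+3 snake A K Y m l (if left_step m.-1 then l.+1 else r.-1) r
     (if left_step m then l.-1 else r.+1).
Proof.
move=> l r; set v := if _ then l.+1 else _; set u := if _ then l.-1 else _.
have mn : (m <= n)%N by rewrite -ltnS.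
have lb := left_end_bound mn; rewrite -/l in lb.
have st := left_end_step m; rewrite -/l in st.
have ln : left_step m -> (m < n)%N by case/andP.
have pre : (0 < m)%N -> left_end m.-1 = (left_step m.-1 + l)%N.
  by move=> m0; rewrite left_end_step prednK.
have post (j : 'I_n.+1) : left_end j = (left_step j + left_end j.+1)%N := left_end_step j.
have hyps : cyc l v r u /\ (v <= n.+3)%N /\ (u <= n.+3)%N.
  rewrite /cyc /u /v /r; move: st; case: left_step; case: left_step; lia.
have [h1 [h2 h3]] := hyps.
split=> //.
- by split=> //; lia.
- by rewrite /same /snake !eqxx.
- have below : edge n.+3 snake l v /\ edge n.+3 snake v r.
    (* At [m = 0] the two candidates [l.+1] and [r.-1] for [v] coincide. *)
    have [m0|m0] := posnP m.
      rewrite /edge /side /v /r m0; case: left_step; lia.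
    have pm : (m.-1 < n.+1)%N by lia.
    have := pre m0; rewrite /v; case: left_step => /= p.
      split; first by rewrite /edge /side eqxx.
      by apply: (@snake_edge (Ordinal pm)) => /=; lia.
    split; last by rewrite /edge /side; lia.
    by apply: (@snake_edge (Ordinal pm)) => /=; lia.
  have above : edge n.+3 snake r u /\ edge n.+3 snake u l.
    have [m0|m0] := leqP n m.
      have mE : (m : nat) = n by lia.
      rewrite /u /left_step mE ltnn /=; split.
        by rewrite /edge /side eqxx.
      have l0 : l = 0%N by rewrite /l mE left_end_max.
      by rewrite /edge /side /r l0 mE; lia.
    have pm : (m.+1 < n.+1)%N by [].
    move: st; rewrite /u; case: left_step => /= p.
      split; last by rewrite /edge /side; lia.
      by rewrite edge_sym; apply: (@snake_edge (Ordinal pm)) => /=; lia.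
    split; first by rewrite /edge /side eqxx.
    by rewrite edge_sym; apply: (@snake_edge (Ordinal pm)) => /=; lia.
  by case: below; case: above.
- move=> j.
  have [->|jm] := eqVneq j m; first by rewrite Adiag quad_sign_diag // /same /snake !eqxx.
  have [jm1|jm1] := eqVneq (j.+1) m.
    have jE : left_step m.-1 = left_step j by rewrite -jm1.
    rewrite Askew (@snake_up j m jm1); move: h1; rewrite /v jE.
    have := post j; rewrite jm1 -/l; case: left_step => /= p h1.
      by rewrite quad_sign_neg //; rewrite /same /snake /= /r; lia.
    by rewrite quad_sign_pos //; rewrite /same /snake /= /r; lia.
  have [jm2|jm2] := eqVneq (m.+1) j.
    rewrite (@snake_up m j jm2); move: h1 st; rewrite jm2 /u.
    case: left_step => /= h1 p.
      by rewrite quad_sign_pos //; rewrite /same /snake /= /r; lia.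
    by rewrite quad_sign_neg //; rewrite /same /snake /= /r; lia.
  have -> : A j m = 0.
    case: (ltnP j m) => h; first by apply: Afar; lia.
    rewrite Askew Afar ?oppr0 //.
    by move: jm; rewrite -val_eqE /=; lia.
  move: jm; rewrite -val_eqE /= => jm.
  have lenv : (v == l.+1) || (v.+1 == r) by rewrite /v /r; case: left_step; lia.
  have lenu : (u.+1 == l) || (u == r.+1).
    by move: st; rewrite /u /r; case: left_step => /= p; lia.
  (* The sides span [1], [m.+1] or [m.+3] steps (reading [u l] and [r u] as pairs of labels), while
     arc [j] spans [j.+2]. *)
  suff [S1 S2 S3 S4] : [/\ same (snake j) l v = false, same (snake j) v r = false,
     same (snake j) r u = false & same (snake j) u l = false].
    by rewrite /quad_sign S1 S2 S3 S4.
  split; apply/negbTE; move: lenv lenu; rewrite /same /snake /= /r; lia.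
Qed.

Lemma snake_triangulated (K : void -> nat -> bool) Y : triangulated n.+3 snake A K Y.
Proof.
split.
- move=> i j; rewrite /same /snake /= => h; apply: val_inj => /=; lia.
- have W (i j : 'I_n.+1) : (i <= j)%N -> ~~ cross (snake i) (snake j).1 (snake j).2.
    move=> ij; have := left_end_mono i (j - i); rewrite subnKC // => h.
    by apply: nested_noncross => /=; lia.
  move=> i j; case: (leqP i j) => ij; first exact: W.
  by rewrite cross_comm W // ltnW.
- by move=> k; do 4!eexists; apply: snake_quad.
- exists n.+2; split; first by rewrite ltnS leqnn.
  + by apply: (@snake_edge ord_max); rewrite left_end_max.
  + by rewrite /edge /side eqxx.
Qed.

End Snake.

(** The Cartan counterpart fixes the absolute values; the signs amount to an orientation of a path,
    and every orientation is realised by a snake in the polygon with [n + 3] vertices. *)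
Lemma type_A_triangulated n (B : 'M[int]_n) (s : 'S_n) (K : void -> nat -> bool) Y :
  (0 < n)%N -> skew_symmetrizable B ->
  row_perm s (col_perm s (cartan_counterpart B)) = cartan_A n ->
  exists tau, triangulated n.+2 tau B K Y.
Proof.
case: n B s Y => // n B s Y _ [d [d0 dB]] H.
have Hij i j : i != j -> - `|B (s i) (s j)| = cartan_A n.+1 i j.
  by move=> ij; rewrite -H !mxE (inj_eq perm_inj) (negbTE ij).
pose A : 'M[int]_n.+1 := \matrix_(i, j) B (s i) (s j).
have adj (i j : 'I_n.+1) : i.+1 = j :> nat -> `|A i j| = 1 /\ `|A j i| = 1.
  move=> ij; have ne : i != j by rewrite -val_eqE /= -ij; lia.
  have := Hij i j ne; have := Hij j i; rewrite eq_sym => /(_ ne).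
  rewrite !mxE (negbTE ne) (eq_sym j i) (negbTE ne) ij eqxx orbT /=; lia.
have far (i j : 'I_n.+1) : (i.+1 < j)%N -> A i j = 0 /\ A j i = 0.
  move=> ij; have ne : i != j by rewrite -val_eqE /=; lia.
  have := Hij i j ne; have := Hij j i; rewrite eq_sym => /(_ ne).
  rewrite !mxE (negbTE ne) (eq_sym j i) (negbTE ne).
  have -> : (i.+1 == j) || (j.+1 == i) = false by lia.
  have -> : (j.+1 == i) || (i.+1 == j) = false by lia.
  lia.
(* The symmetrizer is positive, so opposite entries have opposite signs, and their absolute values
   already agree. *)
have skew i j : A i j = - A j i.
  have := dB (s i) (s j); have := d0 (s i); have := d0 (s j).
  have [ij|ij|ij] := ltngtP i j.
  - case: (ltnP i.+1 j) => h; first by case: (far i j h) => -> ->.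
    have [|+ +] := adj i j; first lia.
    rewrite !mxE; nia.
  - case: (ltnP j.+1 i) => h; first by case: (far j i h) => -> ->.
    have [|+ +] := adj j i; first lia.
    rewrite !mxE; nia.
  - by move/val_inj: ij => ->; rewrite mxE; nia.
exists (fun k => snake A ((s^-1)%g k)).
apply: (@triangulated_perm _ _ _ A B s K Y); first by move=> i j; rewrite mxE.
by apply: snake_triangulated => // i j h; [case: (adj i j h) | case: (far i j h)].
Qed.

(** * Positivity and degree of the normalised lambda lengths *)

Section NonnegBounded.
Variables (R : numDomainType) (n : nat).
Implicit Types (f g : {mpoly R[n]}) (u v : 'I_n -> nat).

Definition nonneg_bounded u f : Prop :=
  [/\ f != 0, forall m, 0 <= f@_m
    & forall m, m \in msupp f -> forall e, (m e <= u e)%N].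

(** If [0 < m j], the upper neighbour has degree at least 2 in variable [j], so its coefficient
    vanishes and the inequality says that a square is non-negative. *)
Lemma nonneg_bounded_log_concave u f : (forall e, (u e <= 1)%N) ->
  nonneg_bounded u f -> log_concave f.
Proof.
move=> u1 [f0 fge fu]; split=> // j m mj.
have -> : f@_(m + U_(j))%MM = 0.
  apply: memN_msupp_eq0; apply/negP => /fu/(_ j).
  by rewrite mnmDE mnm1E eqxx; have := u1 j; lia.
by rewrite mulr0 exprn_ge0.
Qed.

Lemma nonneg_bounded_X u (m : 'X_{1..n}) : (forall e, (m e <= u e)%N) ->
  nonneg_bounded u 'X_[m].
Proof.
move=> mu; split.
- by rewrite -msupp_eq0 msuppX.
- by move=> m'; rewrite mcoeffX ler0n.
- by move=> m'; rewrite msuppX inE => /eqP ->.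
Qed.

Lemma nonneg_boundedM u v f g : nonneg_bounded u f -> nonneg_bounded v g ->
  nonneg_bounded (fun e => u e + v e)%N (f * g).
Proof.
move=> [f0 fge fu] [g0 gge gv]; split; first by rewrite mulf_neq0.
- by move=> m; rewrite mcoeffM sumr_ge0 // => k _; rewrite mulr_ge0.
- move=> m /msuppM_le /allpairsP [[p q] /= [hp hq ->]] e.
  by rewrite mnmDE leq_add ?fu ?gv.
Qed.

Lemma nonneg_boundedD u f g : nonneg_bounded u f -> nonneg_bounded u g ->
  nonneg_bounded u (f + g).
Proof.
move=> [f0 fge fu] [g0 gge gv]; split.
- apply: contra_neq f0 => fg; apply/mpolyP => m; rewrite mcoeff0.
  have := congr1 (mcoeff m) fg; rewrite mcoeffD mcoeff0 => /eqP.
  by rewrite paddr_eq0 // => /andP [/eqP].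
- by move=> m; rewrite mcoeffD addr_ge0.
- by move=> m /msuppD_le; rewrite mem_cat => /orP [/fu|/gv].
Qed.

Lemma nonneg_boundedS u v f : (forall e, (u e <= v e)%N) ->
  nonneg_bounded u f -> nonneg_bounded v f.
Proof. by move=> uv [f0 fge fu]; split=> // m /fu h e; apply: leq_trans (h e) (uv e). Qed.

End NonnegBounded.

Section TropQP.
Variable n : nat.

Lemma X_QP_neq0 (i : 'I_n) : tofrac ('X_i : {mpoly int[n]}) != 0.
Proof. by rewrite tofrac_eq0 -msupp_eq0 msuppX. Qed.

Lemma trop_QPD (a b : 'rV[int]_n) : trop_QP (a + b) = trop_QP a * trop_QP b.
Proof.
rewrite /trop_QP -big_split /=; apply: eq_bigr => i _.
by rewrite mxE expfzDr // X_QP_neq0.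
Qed.

Lemma trop_QP_neq0 (a : 'rV[int]_n) : trop_QP a != 0.
Proof. by apply/prodf_neq0 => i _; rewrite expfz_neq0 // X_QP_neq0. Qed.

Lemma trop_QP_nat (m : 'X_{1..n}) :
  trop_QP (\row_i (m i)%:Z) = tofrac ('X_[m] : {mpoly int[n]}).
Proof.
rewrite mpolyXE_id rmorph_prod /trop_QP; apply: eq_bigr => i _.
by rewrite mxE -exprnP rmorphXn.
Qed.

End TropQP.

(** * Ptolemy relations from determinants *)

Lemma det2_plucker (F : fieldType) (p q r s : F * F) :
  det2 p r * det2 q s = det2 p q * det2 r s + det2 q r * det2 p s.
Proof. by rewrite /det2; ring. Qed.

(** Putting the smaller label first turns the antisymmetric determinant into a symmetric function on
    chords. *)
Definition unordered_det (F : fieldType) (w : nat -> F * F) x y : F :=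
  if (x < y)%N then det2 (w x) (w y) else det2 (w y) (w x).

Lemma unordered_det_sym (F : fieldType) (w : nat -> F * F) x y :
  unordered_det w x y = unordered_det w y x.
Proof. by rewrite /unordered_det; case: (ltngtP x y) => // ->. Qed.

Lemma unordered_det_ptolemy (F : fieldType) (w : nat -> F * F) a b c d : cyc a b c d ->
  unordered_det w a c * unordered_det w b d =
  unordered_det w a b * unordered_det w c d + unordered_det w b c * unordered_det w d a.
Proof.
set D := unordered_det w; have Dsym : forall x y, D x y = D y x := unordered_det_sym w.
have lin p q r s : (p < q)%N -> (q < r)%N -> (r < s)%N ->
    D p r * D q s = D p q * D r s + D q r * D s p.
  move=> h1 h2 h3; rewrite (Dsym s) /D /unordered_det h1 h2 h3.
  rewrite (ltn_trans h1 h2) (ltn_trans h2 h3) (ltn_trans h1 (ltn_trans h2 h3)).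
  exact: det2_plucker.
case/or4P => /and3P [h1 h2 h3].
- exact: lin.
- by rewrite (Dsym a c) mulrC (lin b c d a) // addrC (mulrC (D c d)).
- by rewrite (Dsym a c) (Dsym b d) (lin c d a b) // (mulrC (D c d)) (mulrC (D d a)).
- by rewrite (Dsym b d) mulrC (lin d a b c) // addrC (mulrC (D d a)).
Qed.

Lemma ptolemy_rescale (F : fieldType) (D M : nat -> nat -> F) a b c d (P Q : F) :
  (forall x y, M x y != 0) ->
  M a c * M b d * P = M a b * M c d -> M a c * M b d * Q = M b c * M d a ->
  D a c * D b d = D a b * D c d + D b c * D d a ->
  D a c / M a c * (D b d / M b d) =
    P * (D a b / M a b * (D c d / M c d)) + Q * (D b c / M b c * (D d a / M d a)).
Proof.
move=> M0 hP hQ hD; rewrite mulf_div hD.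
have MM : M a c * M b d != 0 by rewrite mulf_neq0.
have -> : P = M a b * M c d / (M a c * M b d) by rewrite -hP mulrC mulKf.
have -> : Q = M b c * M d a / (M a c * M b d) by rewrite -hQ mulrC mulKf.
by field; rewrite ?M0.
Qed.

Section Lambda.
Variables (N n : nat) (tau : 'I_n -> nat * nat) (B : 'M[int]_n) (E : Type).
Variables (K : E -> nat -> bool) (Y : E -> 'I_n -> int).
Hypothesis HT : triangulated N tau B K Y.

(** Rescaling by these monomials turns the plain Ptolemy relation into one whose coefficients have
    the positive and negative shear parts as exponents. *)
Definition cut_mon (x y : nat) : 'rV[int]_n :=
  \row_e (cut (tau e) x && cut (tau e) y)%:Z.

Definition shear_pos_mon a b c d : 'rV[int]_n := \row_e (shear_pos (cut (tau e)) a b c d)%:Z.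
Definition shear_neg_mon a b c d : 'rV[int]_n := \row_e (shear_neg (cut (tau e)) a b c d)%:Z.

(* The determinant of the vectors at x and y is L x y times the monomial with
   exponent cut_mon x y. *)
Record lambda (L : nat -> nat -> QP n) : Prop := Lambda {
  lambda_sym : forall x y, L x y = L y x;
  lambda_edge : forall x y, x != y -> (x <= N)%N -> (y <= N)%N -> edge N tau x y -> L x y = 1;
  lambda_ptolemy : forall a b c d, cyc a b c d ->
    L a c * L b d = trop_QP (shear_pos_mon a b c d) * (L a b * L c d) +
                    trop_QP (shear_neg_mon a b c d) * (L b c * L d a)
}.

(** The vectors are chosen so that the determinant of each edge is its own rescaling monomial;
    dividing gives 1 there, and Ptolemy follows from Plücker. *)
Lemma lambda_exists : (0 < N)%N -> exists L, lambda L.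
Proof.
move=> N0; have v0 x y : trop_QP (cut_mon x y) != 0 by apply: trop_QP_neq0.
have [w Hw] := realize HT N0 v0.
have monsym x y : cut_mon x y = cut_mon y x.
  by apply/rowP => e; rewrite !mxE andbC.
exists (fun x y => unordered_det w x y / trop_QP (cut_mon x y)); split.
- by move=> x y; rewrite unordered_det_sym monsym.
- move=> x y xy xN yN e.
  rewrite /unordered_det; case: ltngtP xy => // xy _.
    by rewrite Hw ?xy // divff.
  by rewrite monsym Hw ?xy // ?divff // edge_sym.
- move=> a b c d H.
  have m1 : cut_mon a c + cut_mon b d + shear_pos_mon a b c d = cut_mon a b + cut_mon c d.
    apply/rowP => e; rewrite !mxE; have := @cut_non_alternating (tau e) _ _ _ _ H.
    rewrite /shear_pos; do 4! case: cut => //=.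
  have m2 : cut_mon a c + cut_mon b d + shear_neg_mon a b c d = cut_mon b c + cut_mon d a.
    apply/rowP => e; rewrite !mxE; have := @cut_non_alternating (tau e) _ _ _ _ H.
    rewrite /shear_neg; do 4! case: cut => //=.
  have := congr1 (@trop_QP n) m1; have := congr1 (@trop_QP n) m2.
  rewrite !trop_QPD => e2 e1.
  apply: (ptolemy_rescale (M := fun x y => trop_QP (cut_mon x y))) => //.
  exact: unordered_det_ptolemy.
Qed.

Lemma shear_pos_monE a b c d :
  trop_QP (shear_pos_mon a b c d) =
    tofrac ('X_[[multinom (shear_pos (cut (tau e)) a b c d : nat) | e < n]] : {mpoly int[n]}).
Proof. by rewrite -trop_QP_nat; congr trop_QP; apply/rowP => e; rewrite !mxE mnmE. Qed.

Lemma shear_neg_monE a b c d :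
  trop_QP (shear_neg_mon a b c d) =
    tofrac ('X_[[multinom (shear_neg (cut (tau e)) a b c d : nat) | e < n]] : {mpoly int[n]}).
Proof. by rewrite -trop_QP_nat; congr trop_QP; apply/rowP => e; rewrite !mxE mnmE. Qed.

(** Induction on the number of initial arcs crossed. Without crossings the chord is an edge;
    otherwise the Ptolemy relation with a crossed arc [p q], where [L p q = 1], expresses [L x y] by
    four simpler chords. *)
Lemma lambda_poly L : lambda L -> forall x y, x != y -> (x <= N)%N -> (y <= N)%N ->
  exists2 f : {mpoly int[n]}, nonneg_bounded (fun e => cross (tau e) x y : nat) f
    & L x y = tofrac f.
Proof.
move=> HL x y; have [k] := ubnP (\sum_e cross (tau e) x y)%N.
elim: k x y => // k IH x y; rewrite ltnS => xyk xy xN yN.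
case: (pickP (fun e => cross (tau e) x y)) => [e0 ce0|nc]; last first.
  exists 1.
    by rewrite -(mpolyX0 _ int); apply: nonneg_bounded_X => e; rewrite mnm0E.
  have exy : edge N tau x y.
    by case: ltngtP xy => // h _; [|rewrite edge_sym]; apply: (noncross_edge HT);
      rewrite ?h // => j; rewrite ?(cross_sym _ y) nc.
  by rewrite (lambda_edge HL) // tofrac1.
have [p [q [H ce]]] : exists p q, cyc p x q y /\ same (tau e0) p q.
  case/orP: ce0 => h; [exists (tau e0).1, (tau e0).2 | exists (tau e0).2, (tau e0).1].
    by rewrite /same !eqxx.
  by rewrite cyc_rot cyc_rot h /same !eqxx orbT.
have [pN qN] : (p <= N)%N /\ (q <= N)%N.
  by have [h1 h2 _] := tri_le HT e0; case/chordP: ce h1 h2 => -> /=.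
have nce e : ~~ cross (tau e) p q by rewrite -(same_cross _ ce) (tri_noncross HT).
have Lpq : L p q = 1.
  rewrite (lambda_edge HL) ?(cyc_neq H) //.
  by rewrite /edge; apply/orP; right; apply/existsP; exists e0.
(* Each new chord shares an endpoint with [e0], so [e0] drops out of the crossing count. *)
have self u v : same (tau e0) p q -> (u == p) || (u == q) -> cross (tau e0) u v = false.
  by case/chordP => ->; rewrite /cross /cyc /=; lia.
(* These bounds serve twice: the new chords cross no other arcs than [x y] does, and each Ptolemy
   term obeys the degree bound. *)
have sp e := cross_shear_pos H (nce e); have sn e := cross_shear_neg H (nce e).
have small u v : (forall e, (cross (tau e) u v <= cross (tau e) x y)%N) ->
    cross (tau e0) u v = false -> (\sum_e cross (tau e) u v < k)%N.
  move=> le1 h; apply: leq_trans xyk.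
  rewrite (bigD1 e0) //= [X in (_ < X)%N](bigD1 e0) //= h ce0 add0n add1n ltnS.
  by apply: leq_sum.
have [||f1 g1 F1] := IH p x _ _ pN xN; try by rewrite ?(cyc_neq H).
  by apply: small => [e|]; [have := sp e; lia | rewrite self // eqxx].
have [||f2 g2 F2] := IH q y _ _ qN yN; try by rewrite ?(cyc_neq H).
  by apply: small => [e|]; [have := sp e; lia | rewrite self // eqxx orbT].
have [||f3 g3 F3] := IH x q _ _ xN qN; try by rewrite ?(cyc_neq H).
  by apply: small => [e|]; [have := sn e; lia | rewrite cross_sym self // eqxx orbT].
have [||f4 g4 F4] := IH y p _ _ yN pN; try by rewrite ?(cyc_neq H).
  by apply: small => [e|]; [have := sn e; lia | rewrite cross_sym self // eqxx].
have := lambda_ptolemy HL H; rewrite Lpq mul1r F1 F2 F3 F4 shear_pos_monE shear_neg_monE.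
rewrite -!tofracM -tofracD => ->; eexists; last reflexivity.
have mon_bound (u : 'I_n -> bool) :
    nonneg_bounded (u : 'I_n -> nat) ('X_[[multinom (u e : nat) | e < n]] : {mpoly int[n]}).
  by apply: nonneg_bounded_X => e; rewrite mnmE.
apply: nonneg_boundedD.
  apply: nonneg_boundedS (nonneg_boundedM (mon_bound _) (nonneg_boundedM g1 g2)).
  by move=> e /=; rewrite addnA; apply: sp.
apply: nonneg_boundedS (nonneg_boundedM (mon_bound _) (nonneg_boundedM g3 g4)).
by move=> e /=; rewrite addnA; apply: sn.
Qed.

Lemma lambda_neq0 L : lambda L -> forall x y, x != y -> (x <= N)%N -> (y <= N)%N -> L x y != 0.
Proof.
move=> HL x y xy xN yN; have [f [f0 _ _] ->] := lambda_poly HL xy xN yN.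
by rewrite tofrac_eq0.
Qed.

End Lambda.

(** The lamination of a chord outside the quadrilateral cuts off at most one corner, so its shear is
    zero; the half-step shift makes that of [a c] separate [a b] from [c d]. *)
Lemma shear_quad_chord t a b c d : cyc a b c d ->
  [/\ ~~ cross t a b, ~~ cross t b c, ~~ cross t c d, ~~ cross t d a & ~~ cross t a c] ->
  shear (cut t) a b c d = (same t a c)%:Z.
Proof.
case: t => u v h1 [h2 h3 h4 h5 h6]; apply/eqP; rewrite /shear.
apply: (implyP (implyP (implyP (implyP (implyP (implyP _ h1) h2) h3) h4) h5) h6).
move=> {h1 h2 h3 h4 h5 h6}; move: u v a b c d; order_check.
Qed.

(** Principal coefficients: the elementary laminations of the arcs have the identity as shear matrix
    on their own triangulation. *)
Lemma triangulated_cut N n (tau : 'I_n -> nat * nat) B (K : void -> nat -> bool) Y0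
    (Y : 'I_n -> 'I_n -> int) :
  triangulated N tau B K Y0 -> (forall e k, Y e k = (e == k)%:Z) ->
  triangulated N tau B (fun e => cut (tau e)) Y.
Proof.
move=> HT HY; have [H1 H2 H3 H4] := HT; split=> // k.
have [a [b [c [d Hq]]]] := H3 k; exists a, b, c, d.
have [h1 [h2 h3 h4 h5] h6 [e1 e2 e3 e4] h11 _] := Hq; split=> // e.
rewrite shear_quad_chord //; last first.
  by split; try exact: (edge_noncross HT); rewrite -(same_cross _ h6).
rewrite HY; case: eqVneq => [->|ek]; first by rewrite h6.
by case: (boolP (same _ _ _)) => // h; rewrite (same_inj HT h h6) eqxx in ek.
Qed.

(** * Cluster variables at x = 1 *)

Section Specialization.
Variables (n : nat) (x : 'I_n -> ambient n).
Hypothesis xfree : alg_independent x.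
Implicit Types (z : ambient n) (c : QP n).

Lemma eval_at_neq0 q : q.@[fun=> 1] != 0 -> eval_at x q != 0.
Proof. by apply: contra_neq => /xfree ->; rewrite meval0. Qed.

Lemma eval_atM p q : eval_at x (p * q) = eval_at x p * eval_at x q.
Proof. by rewrite /eval_at rmorphM. Qed.

Lemma eval_atD p q : eval_at x (p + q) = eval_at x p + eval_at x q.
Proof. by rewrite /eval_at rmorphD. Qed.

Lemma eval_at1 : eval_at x 1 = 1.
Proof. by rewrite /eval_at rmorph1. Qed.

Lemma specializes_const c : specializes_at1 x (QP_ambient c) c.
Proof.
exists c%:MP, 1; split; first by rewrite meval1 oner_neq0.
  by rewrite eval_at1 divr1 /eval_at mmapC.
by rewrite mevalC meval1 divr1.
Qed.

Lemma specializes_var i : specializes_at1 x (x i) 1.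
Proof.
exists 'X_i, 1; split; first by rewrite meval1 oner_neq0.
  by rewrite eval_at1 divr1 /eval_at mmapX mmap1U.
by rewrite mevalXU meval1 divr1.
Qed.

Lemma specializes1 : specializes_at1 x 1 1.
Proof. by have := specializes_const 1; rewrite rmorph1. Qed.

Lemma specializesM z z' c c' : specializes_at1 x z c -> specializes_at1 x z' c' ->
  specializes_at1 x (z * z') (c * c').
Proof.
move=> [p [q [q1 -> ->]]] [p' [q' [q1' -> ->]]]; exists (p * p'), (q * q').
apply: And3.
- by rewrite mevalM; exact: (mulf_neq0 q1 q1').
- by rewrite !eval_atM; apply: mulf_div.
- by rewrite !mevalM; apply: mulf_div.
Qed.

Lemma specializesD z z' c c' : specializes_at1 x z c -> specializes_at1 x z' c' ->
  specializes_at1 x (z + z') (c + c').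
Proof.
move=> [p [q [q1 -> ->]]] [p' [q' [q1' -> ->]]]; exists (p * q' + p' * q), (q * q').
apply: And3.
- by rewrite mevalM; exact: (mulf_neq0 q1 q1').
- rewrite eval_atD !eval_atM.
  exact: (addf_div _ _ (eval_at_neq0 q1) (eval_at_neq0 q1')).
- by rewrite mevalD !mevalM; exact: (addf_div _ _ q1 q1').
Qed.

Lemma specializesV z c : c != 0 -> specializes_at1 x z c -> specializes_at1 x z^-1 c^-1.
Proof.
move=> c0 [p [q [q1 zE cE]]]; exists q, p; apply: And3.
- by apply: contra_neq c0 => p0; rewrite cE p0; exact: mul0r.
- by rewrite zE; exact: invf_div.
- by rewrite cE; exact: invf_div.
Qed.

Lemma specializesXz z c (m : int) : c != 0 -> specializes_at1 x z c ->
  specializes_at1 x (z ^ m) (c ^ m).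
Proof.
move=> c0 zc.
have X k : specializes_at1 x (z ^+ k) (c ^+ k).
  elim: k => [|k IH]; first exact: specializes1.
  by rewrite (exprS z) (exprS c); exact: specializesM zc IH.
case: m => k; first exact: X.
by rewrite NegzE -!exprnN; exact: specializesV (expf_neq0 _ c0) (X _).
Qed.

Lemma specializes_prod (I : finType) (z : I -> ambient n) (c : I -> QP n) :
  (forall i, specializes_at1 x (z i) (c i)) ->
  specializes_at1 x (\prod_i z i) (\prod_i c i).
Proof.
move=> zc; apply: (big_rec2 (fun z c => specializes_at1 x z c)); first exact: specializes1.
by move=> i z' c' _; apply: specializesM.
Qed.

End Specialization.

(** At most one arc is the chord [a b]. If there is none, [a b] is a side of the polygon, and the
    empty product agrees with [L a b = 1]. *)
Lemma prod_lambda_same N n (tau : 'I_n -> nat * nat) (m : nat) (tau0 : 'I_m -> nat * nat) B (E : Type)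
    (K : E -> nat -> bool) Y (L : nat -> nat -> QP m) a b :
  triangulated N tau B K Y -> lambda N tau0 L ->
  a != b -> (a <= N)%N -> (b <= N)%N -> edge N tau a b ->
  \prod_j L (tau j).1 (tau j).2 ^ (same (tau j) a b)%:Z = L a b.
Proof.
move=> HT HL ab aN bN eab.
case: (pickP (fun j => same (tau j) a b)) => [j0 Hj0|no]; last first.
  rewrite big1 => [|j _]; last by rewrite no.
  rewrite (lambda_edge HL) //; apply/orP; left.
  by case/orP: eab => // /existsP [j]; rewrite no.
rewrite (bigD1 j0) //= Hj0 big1 => [|j jj0].
  by rewrite mulr1; case/chordP: Hj0 => -> //=; rewrite (lambda_sym HL).
case: (boolP (same (tau j) a b)) => // h.
by rewrite (same_inj HT h Hj0) eqxx in jj0.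
Qed.

(** * Transport of triangulations along the tree of seeds *)

Lemma tree_connected n (P : tree n -> Prop) (t0 : tree n) : P t0 ->
  (forall (k : 'I_n) t u, tree_edge k t u -> P t -> P u) -> forall t, P t.
Proof.
move=> P0 step.
(* Edges can be walked both ways, so each vertex is equivalent to the root, by removing last
   letters. *)
have root_iff w (hw : reduced_word w) (h0 : reduced_word [::]) :
    P (exist _ w hw) <-> P (exist _ [::] h0).
  elim/last_ind: w hw => [|w k IH] hw; first by rewrite (bool_irrelevance hw h0).
  have hw' : reduced_word w.
    by move: hw; rewrite /reduced_word; case: w {IH} => //= a w; rewrite rcons_path => /andP [].
  rewrite -(IH hw'); split; apply: (step k).
    by rewrite /tree_edge /= eqxx orbT.
  by rewrite /tree_edge /= eqxx.
case=> w hw; apply/(root_iff w hw isT).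
by case: t0 P0 => w0 hw0 /root_iff; apply.
Qed.

Definition coeff_exps n (S : cluster_pattern n) t (e k : 'I_n) : int :=
  (coeffs (S t) k : 'rV[int]_n) 0 e.

Lemma mutate_coeffsE n (k : 'I_n) (s : seed n) (i e : 'I_n) :
  (coeffs (mutate k s) i : 'rV[int]_n) 0 e =
  if i == k then - (coeffs s k : 'rV[int]_n) 0 e
  else (coeffs s i : 'rV[int]_n) 0 e
     + (coeffs s k : 'rV[int]_n) 0 e * pos_part (exchange s k i)
     + Num.min 0 ((coeffs s k : 'rV[int]_n) 0 e) * - exchange s k i.
Proof.
rewrite /= ffunE; case: ifP => _; first by rewrite mxE.
rewrite -!scaler_int !mxE !intz; congr (_ + _ + _); exact: mulrC.
Qed.

Lemma mutate_exchangeE n (k : 'I_n) (s : seed n) (i j : 'I_n) :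
  exchange (mutate k s) i j = if (i == k) || (j == k) then - exchange s i j
   else exchange s i j + pos_part (exchange s i k) * exchange s k j
        + exchange s i k * pos_part (- exchange s k j).
Proof. by rewrite mxE. Qed.

Lemma skew_symmetrizable_eq0 n (B : 'M[int]_n) : skew_symmetrizable B ->
  forall i j, B i j = 0 -> B j i = 0.
Proof.
move=> [d [d0 dB]] i j Bij; have := dB i j; rewrite Bij mulr0 => /eqP.
by rewrite eq_sym oppr_eq0 mulf_eq0 gt_eqF // => /eqP.
Qed.

Lemma exchange_eq0 n (S : cluster_pattern n) t i j :
  exchange (S t) i j = 0 -> exchange (S t) j i = 0.
Proof. by case: (seed_at_labeled S t) => _ _ h; apply: skew_symmetrizable_eq0. Qed.

(** Flips carry the snake from the vertex with the Dynkin matrix to every other vertex, in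
    particular to an arbitrary initial one. *)
Lemma type_A_all_triangulated n (S : cluster_pattern n) (K : void -> nat -> bool) Y :
  (0 < n)%N -> type_A S ->
  forall t, exists tau, triangulated n.+2 tau (exchange (S t)) K Y.
Proof.
move=> n0 [t1 [s hs]]; apply: (@tree_connected _ _ t1).
  by case: (seed_at_labeled S t1) => _ _ sk; apply: type_A_triangulated hs.
move=> k t u tu [tau HT]; have [a [b [c [d Hq]]]] := tri_quad HT k.
exists (fun i => if i == k then (b, d) else tau i); rewrite (seed_at_edge S tu).
apply: (triangulated_flip HT _ (@exchange_eq0 _ S t) _ _ _ Hq) => //.
- by move=> i /negbTE ->.
- exact: mutate_exchangeE.
- by rewrite eqxx /same !eqxx.
Qed.

Section Pattern.
Variables (n : nat) (S : cluster_pattern n) (t0 : tree n).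
Variables (N : nat) (tau0 : 'I_n -> nat * nat) (L : nat -> nat -> QP n).
Hypothesis HT0 : triangulated N tau0 (exchange (S t0)) (fun e => cut (tau0 e)) (coeff_exps S t0).
Hypothesis HL : lambda N tau0 L.

Definition arcs_specialize t : Prop := exists2 tau,
  triangulated N tau (exchange (S t)) (fun e => cut (tau0 e)) (coeff_exps S t)
  & forall i, specializes_at1 (cluster (S t0)) (cluster (S t) i) (L (tau i).1 (tau i).2).

Lemma L_tri_neq0 t tau :
  triangulated N tau (exchange (S t)) (fun e => cut (tau0 e)) (coeff_exps S t) ->
  forall i, L (tau i).1 (tau i).2 != 0.
Proof. by move=> HT i; have [? ? ?] := tri_le HT i; apply: (lambda_neq0 HT0 HL). Qed.

(** At [x = 1] the exchange relation becomes the Ptolemy relation of the quadrilateral of [k],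
    solved for [L b d]. *)
Lemma arcs_specialize_edge k t u : tree_edge k t u -> arcs_specialize t -> arcs_specialize u.
Proof.
move=> tu [tau HT Hx]; have [a [b [c [d Hq]]]] := tri_quad HT k.
have [xfree _ _] := seed_at_labeled S t0.
have [H1 [aN bN cN dN] H6 [e1 e2 e3 e4] H11 H12] := Hq.
exists (fun i => if i == k then (b, d) else tau i); rewrite /coeff_exps (seed_at_edge S tu).
  apply: (triangulated_flip HT _ (@exchange_eq0 _ S t) _ _ _ Hq) => //.
  - by move=> e; apply: cut_non_alternating.
  - by move=> i /negbTE ->.
  - exact: mutate_exchangeE.
  - by move=> e i; apply: mutate_coeffsE.
  - by rewrite eqxx /same !eqxx.
move=> i; rewrite /= ffunE; case: eqVneq => // _ /=.
have nz := L_tri_neq0 HT.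
have prodE p q r s : cyc p q r s -> [/\ p <= N, q <= N, r <= N & s <= N]%N ->
    edge N tau p q -> edge N tau r s ->
    \prod_j L (tau j).1 (tau j).2 ^ ((same (tau j) p q)%:Z + (same (tau j) r s)%:Z)
    = L p q * L r s.
  move=> H [pN qN rN sN] epq ers.
  rewrite -(prod_lambda_same HT HL _ pN qN epq) ?(cyc_neq H) //.
  rewrite -(prod_lambda_same HT HL _ rN sN ers) ?(cyc_neq H) // -big_split /=.
  by apply: eq_bigr => j _; rewrite expfzDr.
have Lac : L (tau k).1 (tau k).2 = L a c.
  by case/chordP: H6 => -> //=; rewrite (lambda_sym HL).
have -> : L b d = (L a c)^-1 * (trop_QP (shear_pos_mon tau0 a b c d) * (L a b * L c d) +
                    trop_QP (shear_neg_mon tau0 a b c d) * (L b c * L d a)).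
  by rewrite -(lambda_ptolemy HL H1) mulKf // -Lac.
rewrite -Lac; apply: specializesM; first exact: specializesV.
have Hshear e : (coeffs (S t) k : 'rV[int]_n) 0 e = shear (cut (tau0 e)) a b c d := H12 e.
apply: (specializesD xfree); apply: specializesM.
(* The positive and negative shear indicators are never both 1, so the minimum of 0 and their
   difference is minus the negative one. *)
- have -> : shear_pos_mon tau0 a b c d = (coeffs (S t) k : 'rV[int]_n) - trop_oplus 0 (coeffs (S t) k).
    apply/rowP => e; rewrite !mxE Hshear /shear /shear_pos /shear_neg.
    by do 4! case: cut.
  exact: specializes_const.
- rewrite -prodE //; apply: specializes_prod => j.
  have [hp _ _] := quad_signP (tau j) H1; rewrite -hp -H11.
  exact: specializesXz.
- have -> : shear_neg_mon tau0 a b c d = - trop_oplus 0 (coeffs (S t) k).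
    apply/rowP => e; rewrite !mxE Hshear /shear /shear_pos /shear_neg.
    by do 4! case: cut.
  exact: specializes_const.
- rewrite -prodE //; last by rewrite -cyc_rot.
  apply: specializes_prod => j.
  have [_ hp _] := quad_signP (tau j) H1; rewrite -hp -H11.
  exact: specializesXz.
Qed.

Lemma arcs_specialize_all t : arcs_specialize t.
Proof.
apply: (@tree_connected _ _ t0); last exact: arcs_specialize_edge.
exists tau0 => // i; have [h1 h2 h3] := tri_le HT0 i.
rewrite (lambda_edge HL) //; first exact: specializes_var.
by apply/orP; right; apply/existsP; exists i; rewrite /same !eqxx.
Qed.

End Pattern.

Theorem theorem1p4 (n : nat) (hn : (1 <= n)%N)
  (S : cluster_pattern n) (t0 : tree n)
  (hprincipal : principal_at S t0) (htype : type_A S)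
  (i : 'I_n) (t : tree n) :
  log_concave (F_polynomial S t0 i t).
Proof.
have [tau0 HTv] := @type_A_all_triangulated _ S (fun=> fun=> false) (fun=> fun=> 0) hn htype t0.
have HT0 : triangulated n.+2 tau0 (exchange (S t0)) (fun e => cut (tau0 e)) (coeff_exps S t0).
  apply: triangulated_cut HTv _ => e k.
  by rewrite /coeff_exps hprincipal /trop_gen mxE eqxx; case: (e == k).
have [L HL] := lambda_exists HT0 (ltn0Sn _).
have [tau HT Hx] := arcs_specialize_all HT0 HL t.
have [h1 h2 h3] := tri_le HT i.
have [f fbd Lf] := lambda_poly HT0 HL h3 h1 h2.
have Ff : is_F_polynomial S t0 i t f by rewrite /is_F_polynomial -Lf.
(* The polynomial [f] witnesses existence, and uniqueness identifies it with the value of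
   [epsilon]. *)
have -> : F_polynomial S t0 i t = f.
  exact: is_F_polynomial_inj (epsilon_spec _ _ (ex_intro _ f Ff)) Ff.
by apply: nonneg_bounded_log_concave fbd => e; case: cross.
Qed.
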